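(* Assume that $A(S)\subseteq \mathrm{ri}(\mathrm{dom}\, g)$, that $\inf_{x\in S}F(x)>-\infty$, that $K(S)\subseteq \mathrm{ri}(\mathrm{dom}\, f)$, and that $r>0$ is such that $\mathcal K_r:=\{z\in\mathbb R^s: \mathrm{dist}(z,A(S))\le r\}\subseteq \mathrm{int}(\mathrm{dom}\, g)$; let $\ell_{g,\mathcal K_r}>0$ be the Lipschitz constant of $g$ on $\mathcal K_r$. For $0<\gamma\le \frac{2r}{\ell_{g,\mathcal K_r}}$ and $\|z^0\|\le \ell_{g,\mathcal K_r}$, let $(x^k,y^k,z^k)_{k\ge0}$ be the sequence generated by the Adaptive DPFS algorithm (described in the context), where the scalar sequences $(\alpha_k)_{k\ge0}$, $(\beta_k)_{k\ge0}$, $(\delta_k)_{k\ge0}$ and $(\rho_k)_{k\ge0}$ are chosen such that the conditions (P1)-(P5) listed in the context are satisfied. Assume in addition that $g$ is essentially strictly convex and $\mathrm{int}(\mathrm{dom}\, f)\ne\emptyset$. Let $0<\varepsilon\le r$ (with $\varepsilon$ the tolerance used in the algorithm). Suppose that there exists $\theta\in[0,1)$ such that $\varpi$ (defined in the context) satisfies the Kurdyka-Łojasiewicz property at every $(x,y,z,u)\in\mathrm{dom}\,\partial\varpi$ with desingularization function $\phi(s)=\frac{\sigma}{1-\theta}s^{1-\theta}$ for some $\sigma>0$, and let $(\overline x,\overline y,\overline z)$ be the limit of $(x^k,y^k,z^k)_{k\ge0}$ as $k\to+\infty$. Let $K_0$ be as in the context. Then the following statements are true: (i) if $\theta=0$,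 then $(x^k,y^k,z^k)_{k\ge0}$ converges in finite time; (ii) if $\theta\in(0,\frac12]$, then there exist $\widehat K_1\ge K_0+2$ and $\widehat q\in(0,1)$, and a constant $\widehat\kappa_1>0$ such that for all $k\ge\widehat K_1$ $$\|x^k-\overline x\|\le\widehat\kappa_1\widehat q^{\,k},\quad\|y^k-\overline y\|\le\widehat\kappa_1\widehat q^{\,k},\quad\|z^k-\overline z\|\le\widehat\kappa_1\widehat q^{\,k};$$ (iii) if $\theta\in(\frac12,1)$, then there exist $\widehat K_1\ge K_0+2$ and a constant $\widehat\kappa_2>0$ such that for all $k\ge\widehat K_1$ $$\|x^k-\overline x\|\le\widehat\kappa_2k^{-\frac{1-\theta}{2\theta-1}},\quad\|y^k-\overline y\|\le\widehat\kappa_2k^{-\frac{1-\theta}{2\theta-1}},\quad\|z^k-\overline z\|\le\widehat\kappa_2k^{-\frac{1-\theta}{2\theta-1}}.$$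
   Context: Setting. $S\subseteq\mathbb R^n$ is nonempty, convex and compact; $f:\mathbb R^p\to\mathbb R\cup\{\pm\infty\}$ and $g:\mathbb R^s\to\mathbb R\cup\{\pm\infty\}$ are proper, convex and lower semicontinuous; $A:\mathbb R^n\to\mathbb R^s$ and $K:\mathbb R^n\to\mathbb R^p$ are linear with adjoints $A^*,K^*$; $\varphi:\mathbb R^n\to\mathbb R$ is differentiable with $\ell_{\nabla\varphi}$-Lipschitz continuous gradient. $F(x):=g(Ax)+\varphi(x)-f(Kx)$. $\sigma_A:=\|A\|^2$ is the largest eigenvalue of $A^*A$. $\mathrm{dom}\,h=\{x:h(x)<+\infty\}$; $\mathrm{ri}$ and $\mathrm{int}$ denote relative interior and interior; $\mathrm{dist}(z,C)=\inf_{c\in C}\|z-c\|$; $h^*$ is the Fenchel conjugate of $h$; $\mathrm{Proj}_S$ is the projection onto $S$; $\iota_S$ is the indicator function of $S$; $\mathrm{Prox}_{h,t}(w):=\arg\min_x\{h(x)+\frac1{2t}\|x-w\|^2\}$. A proper function is essentially strictly convex if it is strictly convex on every nonempty convex subset of the domain of its subdifferential. Parameter conditions (with $\gamma>0$, $\frac\gamma2>\alpha>0$, $\mu>0$): (P1) $\lim_{k\to+\infty}\alpha_k=\alpha$ and $\alpha+\gamma\ge\alpha_0\ge\alpha_k\ge\alpha_{k+1}>\alpha$ for all $k\ge0$; (P2) $\frac{\alpha_k-\alpha_{k+1}}{(\alpha_{k+1}-\alpha)(\alpha_k-\alpha)}\le\frac1\gamma$ and $(\alpha_k-\alpha)(\alpha_{k+2}-\alpha)\ge(\alpha_{k+1}-\alpha)^2$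 for all $k\ge0$; (P3) $+\infty>\overline\beta\ge\beta_k\ge\underline\beta>0$ for all $k\ge0$; (P4) $\delta_k:=\frac{\alpha}{\alpha_k}$ for all $k\ge0$; (P5) $\rho_k:=\frac{\ell_{\nabla\varphi}}2+\frac{3\sigma_A\gamma}{2(\alpha_k-\alpha)^2}+\mu$ for all $k\ge0$. Adaptive DPFS. Given $\ell_{\nabla\varphi}>0$, $\sigma_A>0$, choose $\beta_0>0$, $\rho_0>0$, $0<\alpha<\frac\gamma2$, $\alpha_0=\alpha+\gamma$, $\delta_0=\frac\alpha{\alpha_0}$, $\mu>0$, $\varepsilon>0$ and a starting point $(x^0,y^0,z^0)$. For $k=0,1,2,\dots$: $x^{k+1}:=\mathrm{Proj}_S\big(x^k+\frac1{\rho_k}(-\nabla\varphi(x^k)+K^*y^k-A^*z^k)\big)$, $y^{k+1}:=\mathrm{Prox}_{f^*,1/\beta_k}(y^k+\frac1{\beta_k}Kx^{k+1})$, $z^{k+1}:=\mathrm{Prox}_{g^*,1/\alpha_k}(\delta_kz^k+\frac1{\alpha_k}Ax^{k+1})$; if $(\alpha_k-\alpha)\|z^{k+1}\|>\varepsilon$, then update $\alpha_{k+1}$ according to (P1) and (P2), and set $\rho_{k+1}:=\frac{\ell_{\nabla\varphi}}2+\frac{3\gamma\sigma_A}{2(\alpha_{k+1}-\alpha)^2}+\mu$, $\delta_{k+1}:=\frac\alpha{\alpha_{k+1}}$; otherwise set $\alpha_{k+1}:=\alpha_k$, $\rho_{k+1}:=\rho_k$, $\delta_{k+1}:=\delta_k$.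 In either case update $\beta_{k+1}$ dynamically to satisfy (P3). Merit function. Let $K_0\ge0$ be an index and $\widetilde\alpha>\alpha>0$ the constant (given by the result that the algorithm is well-defined) such that for all $k\ge K_0$: $\alpha_k=\widetilde\alpha$, $\rho_k=\frac{\ell_{\nabla\varphi}}2+\frac{3\sigma_A\gamma}{2(\widetilde\alpha-\alpha)^2}+\mu$, $\delta_k=\frac\alpha{\widetilde\alpha}$ and $(\alpha_k-\alpha)\|z^{k+1}\|\le\varepsilon$. With this $\widetilde\alpha$, $$\varpi(x,y,z,u):=\langle z,Ax\rangle-g^*(z)+\varphi(x)+\iota_S(x)-\langle Kx,y\rangle+f^*(y)+\frac\alpha2\Big(1+\frac{4\alpha}{\widetilde\alpha-\alpha}\Big)\|z-u\|^2-\frac12(\widetilde\alpha-\alpha)\|z\|^2 .$$ Subdifferential and KL property. For an extended-real-valued $h$ and $\bar w$ with $h(\bar w)\in\mathbb R$, the Fréchet subdifferential is $\widehat\partial h(\bar w)=\{v:\liminf_{w\to\bar w,w\ne\bar w}\frac{h(w)-h(\bar w)-\langle v,w-\bar w\rangle}{\|w-\bar w\|}\ge0\}$ and the limiting subdifferential $\partial h(\bar w)$ is the set of limits $v$ of sequences $v^k\in\widehat\partial h(w^k)$ with $w^k\to\bar w$, $h(w^k)\to h(\bar w)$; both are empty if $h(\bar w)\notin\mathbb R$. $\mathrm{dom}\,\partial h=\{w:\partial h(w)\neq\emptyset\}$. A proper function $h$ satisfies the Kurdyka-Łojasiewicz (KL) property at $\widehat w\in\mathrm{dom}\,\partial h$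 with desingularization function $\phi$ if there are $\eta\in(0,+\infty]$ and an open neighborhood $U$ of $\widehat w$ such that $\phi:[0,\eta)\to[0,+\infty)$ is concave and continuous, $\phi(0)=0$, $\phi$ is continuously differentiable on $(0,\eta)$ with $\phi'>0$ there, and $\phi'(h(w)-h(\widehat w))\,\mathrm{dist}(0,\partial h(w))\ge1$ for all $w\in U$ with $h(\widehat w)<h(w)<h(\widehat w)+\eta$. For $h=\varpi$, the neighborhood $U$ is restricted so that $U\subseteq\mathbb R^n\times\mathbb R^p\times\mathrm{int}(\mathrm{dom}\, g^* )\times\mathbb R^s$, where $\varpi$ is lower semicontinuous (one has $\mathrm{dom}\,\partial\varpi\subseteq\mathbb R^n\times\mathbb R^p\times\mathrm{int}(\mathrm{dom}\, g^* )\times\mathbb R^s$ when $g$ is essentially strictly convex). *)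

(* Defs.v *)
From HB Require Import structures.
From mathcomp Require Import all_boot all_order all_algebra.
From mathcomp Require Import all_classical all_reals all_analysis.

Set Implicit Arguments.
Unset Strict Implicit.
Unset Printing Implicit Defensive.

Import Order.TTheory GRing.Theory Num.Theory.
Import numFieldNormedType.Exports.

Local Open Scope classical_set_scope.
Local Open Scope ring_scope.

(* The library norm [`|x|] on matrices is the sup norm, so the Euclidean norm
   is introduced separately; both induce the same topology, hence the library
   notions of limit, interior, open set and differentiability are used as is. *)
Definition dot (R : realType) (d : nat) (x y : 'cV[R]_d) : R :=
  \sum_(i < d) x i 0 * y i 0.

Definition enorm (R : realType) (d : nat) (x : 'cV[R]_d) : R :=
  Num.sqrt (dot x x).

Definition opnorm (R : realType) (m d : nat) (A : 'M[R]_(m, d)) : R :=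
  sup [set enorm (A *m x) | x in [set x : 'cV[R]_d | enorm x <= 1]].

Definition gradient (R : realType) (d : nat) (h : 'cV[R]_d -> R)
  (x : 'cV[R]_d) : 'cV[R]_d := \col_(i < d) 'D_(delta_mx i 0) h x.

(* Valued in [\bar R] so that the distance to the empty set is [+oo]. *)
Definition dist (R : realType) (d : nat) (z : 'cV[R]_d) (C : set 'cV[R]_d) :
  \bar R := ereal_inf [set (enorm (z - c))%:E | c in C].

Definition aff_hull (R : realType) (d : nat) (C : set 'cV[R]_d) :
  set 'cV[R]_d :=
  [set z | exists (m : nat) (c : 'I_m -> 'cV[R]_d) (l : 'I_m -> R),
     [/\ forall i, C (c i), \sum_(i < m) l i = 1 &
         z = \sum_(i < m) l i *: c i]].

Definition rel_interior (R : realType) (d : nat) (C : set 'cV[R]_d) :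
  set 'cV[R]_d :=
  [set z | C z /\ exists2 U, nbhs z U & U `&` aff_hull C `<=` C].

Definition proj (R : realType) (d : nat) (S : set 'cV[R]_d) (w : 'cV[R]_d) :
  set 'cV[R]_d :=
  [set x | S x /\ forall c, S c -> enorm (x - w) <= enorm (c - w)].

Section ExtendedRealFunctions.
Local Open Scope ereal_scope.

Definition edom (R : realType) (d : nat) (h : 'cV[R]_d -> \bar R) :
  set 'cV[R]_d := [set x | h x < +oo].

Definition eproper (R : realType) (d : nat) (h : 'cV[R]_d -> \bar R) : Prop :=
  (forall x, -oo < h x) /\ edom h !=set0.

(* Only used for functions that never take the value [-oo], so the right-hand
   side contains no [+oo - oo]. *)
Definition econvex (R : realType) (d : nat) (h : 'cV[R]_d -> \bar R) : Prop :=
  forall (x y : 'cV[R]_d) (t : R), (0 <= t <= 1)%R ->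
    h (t *: x + (1 - t) *: y)%R <= t%:E * h x + (1 - t)%:E * h y.

Definition strictly_econvex_on (R : realType) (d : nat) (C : set 'cV[R]_d)
  (h : 'cV[R]_d -> \bar R) : Prop :=
  forall (x y : 'cV[R]_d) (t : R), C x -> C y -> x <> y -> (0 < t < 1)%R ->
    h (t *: x + (1 - t) *: y)%R < t%:E * h x + (1 - t)%:E * h y.

Definition conjugate (R : realType) (d : nat) (h : 'cV[R]_d -> \bar R)
  (y : 'cV[R]_d) : \bar R :=
  ereal_sup (range (fun x : 'cV[R]_d => (dot y x)%:E - h x)).

Definition indicator (R : realType) (d : nat) (S : set 'cV[R]_d)
  (x : 'cV[R]_d) : \bar R := if `[< S x >] then 0 else +oo.

Definition argmin (R : realType) (d : nat) (h : 'cV[R]_d -> \bar R) :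
  set 'cV[R]_d := [set x | forall y, h x <= h y].

Definition prox (R : realType) (d : nat) (h : 'cV[R]_d -> \bar R) (t : R)
  (w : 'cV[R]_d) : set 'cV[R]_d :=
  argmin (fun x => h x + ((2 * t)^-1 * enorm (x - w) ^+ 2)%:E).

Definition frechet_subdiff (R : realType) (d : nat) (h : 'cV[R]_d -> \bar R)
  (w : 'cV[R]_d) : set 'cV[R]_d :=
  [set v | h w \is a fin_num /\
     0 <= limf_einf (fun u : 'cV[R]_d =>
            (h u - h w - (dot v (u - w))%:E) * ((enorm (u - w))^-1)%:E)
          (w^')].

Definition lim_subdiff (R : realType) (d : nat) (h : 'cV[R]_d -> \bar R)
  (w : 'cV[R]_d) : set 'cV[R]_d :=
  [set v | h w \is a fin_num /\
     exists wk vk : nat -> 'cV[R]_d,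
       [/\ forall k, frechet_subdiff h (wk k) (vk k),
           wk @ \oo --> w, (h \o wk) @ \oo --> h w & vk @ \oo --> v]].

Definition dom_subdiff (R : realType) (d : nat) (h : 'cV[R]_d -> \bar R) :
  set 'cV[R]_d := [set w | lim_subdiff h w !=set0].

Definition essentially_strictly_convex (R : realType) (d : nat)
  (h : 'cV[R]_d -> \bar R) : Prop :=
  forall C : set 'cV[R]_d, C !=set0 -> convex_set C -> C `<=` dom_subdiff h ->
    strictly_econvex_on C h.

Definition desingularization (R : realType) (eta : \bar R) (phi : R -> R) :
  Prop :=
  let I0 := [set t : R | (0 <= t)%R /\ t%:E < eta] in
  let I1 := [set t : R | (0 < t)%R /\ t%:E < eta] in
  [/\ (forall t, I0 t -> (0 <= phi t)%R) /\ phi 0%R = 0%R,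
      forall (t1 t2 l : R), I0 t1 -> I0 t2 -> (0 <= l <= 1)%R ->
        (l * phi t1 + (1 - l) * phi t2 <= phi (l * t1 + (1 - l) * t2))%R,
      {within I0, continuous phi},
      forall t, I1 t -> derivable phi t 1 /\ (0 < derive1 phi t)%R &
      {within I1, continuous (derive1 phi)}].

(* [D] is the region to which the neighbourhood [U] is confined.  In the last
   clause [h w] and [h wh] are finite, and [dist _ set0 = +oo]. *)
Definition KL_property (R : realType) (d : nat) (D : set 'cV[R]_d)
  (h : 'cV[R]_d -> \bar R) (phi : R -> R) (wh : 'cV[R]_d) : Prop :=
  dom_subdiff h wh /\
  exists (eta : \bar R) (U : set 'cV[R]_d),
    [/\ 0 < eta, open U /\ U wh, U `<=` D, desingularization eta phi &
        forall w, U w -> h wh < h w -> h w < h wh + eta ->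
          1 <= (derive1 phi (fine (h w - h wh)))%:E * dist 0%R (lim_subdiff h w)].

Definition objective (R : realType) (n p s : nat)
  (f : 'cV[R]_p -> \bar R) (g : 'cV[R]_s -> \bar R)
  (A : 'M[R]_(s, n)) (K : 'M[R]_(p, n)) (vphi : 'cV[R]_n -> R)
  (x : 'cV[R]_n) : \bar R := g (A *m x)%R + (vphi x)%:E - f (K *m x)%R.

Definition merit (R : realType) (n p s : nat) (S : set 'cV[R]_n)
  (f : 'cV[R]_p -> \bar R) (g : 'cV[R]_s -> \bar R)
  (A : 'M[R]_(s, n)) (K : 'M[R]_(p, n)) (vphi : 'cV[R]_n -> R)
  (al alt : R) (x : 'cV[R]_n) (y : 'cV[R]_p) (z u : 'cV[R]_s) : \bar R :=
  (dot z (A *m x))%:E - conjugate g z + (vphi x)%:E + indicator S x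
  - (dot (K *m x) y)%:E + conjugate f y
  + (al / 2 * (1 + 4 * al / (alt - al)) * enorm (z - u) ^+ 2)%:E
  - (2^-1 * (alt - al) * enorm z ^+ 2)%:E.

End ExtendedRealFunctions.

(* R^n x R^p x R^s x R^s is identified with R^(n + (p + (s + s))), so that its
   norm and inner product are the Euclidean ones. *)
Definition blk_x (R : realType) (n p s : nat)
  (w : 'cV[R]_(n + (p + (s + s)))) : 'cV[R]_n := usubmx w.
Definition blk_y (R : realType) (n p s : nat)
  (w : 'cV[R]_(n + (p + (s + s)))) : 'cV[R]_p := usubmx (dsubmx w).
Definition blk_z (R : realType) (n p s : nat)
  (w : 'cV[R]_(n + (p + (s + s)))) : 'cV[R]_s := usubmx (dsubmx (dsubmx w)).
Definition blk_u (R : realType) (n p s : nat)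
  (w : 'cV[R]_(n + (p + (s + s)))) : 'cV[R]_s := dsubmx (dsubmx (dsubmx w)).

(* Where [conjugate g z] and [indicator S x] are both [+oo] the sum defining
   [merit] is [-oo] by the library convention.  Such [z] lie outside the domain
   of [conjugate g], hence outside [merit_region]. *)
Definition merit_vec (R : realType) (n p s : nat) (S : set 'cV[R]_n)
  (f : 'cV[R]_p -> \bar R) (g : 'cV[R]_s -> \bar R)
  (A : 'M[R]_(s, n)) (K : 'M[R]_(p, n)) (vphi : 'cV[R]_n -> R)
  (al alt : R) (w : 'cV[R]_(n + (p + (s + s)))) : \bar R :=
  merit S f g A K vphi al alt (blk_x w) (blk_y w) (blk_z w) (blk_u w).

Definition merit_region (R : realType) (n p s : nat)
  (g : 'cV[R]_s -> \bar R) : set 'cV[R]_(n + (p + (s + s))) :=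
  [set w | (edom (conjugate g))° (blk_z w)].

Definition P1 (R : realType) (gamma al : R) (a : nat -> R) : Prop :=
  a @ \oo --> al /\
  forall k, [/\ a 0%N <= al + gamma, a k <= a 0%N, a k.+1 <= a k & al < a k.+1].

Definition P2 (R : realType) (gamma al : R) (a : nat -> R) : Prop :=
  forall k,
    (a k - a k.+1) / ((a k.+1 - al) * (a k - al)) <= gamma^-1 /\
    (a k.+1 - al) ^+ 2 <= (a k - al) * (a k.+2 - al).

Definition P3 (R : realType) (beta : nat -> R) : Prop :=
  exists blo bup : R, 0 < blo /\ forall k, blo <= beta k <= bup.

Definition P4 (R : realType) (al : R) (alpha delta : nat -> R) : Prop :=
  forall k, delta k = al / alpha k.

Definition P5 (R : realType) (lphi sigmaA gamma al mu : R)
  (alpha rho : nat -> R) : Prop :=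
  forall k, rho k =
    lphi / 2 + 3 * sigmaA * gamma / (2 * (alpha k - al) ^+ 2) + mu.

Definition nb_updates (R : realType) (s : nat) (al eps : R)
  (alpha : nat -> R) (z : nat -> 'cV[R]_s) (k : nat) : nat :=
  (\sum_(i < k) (eps < (alpha i - al) * enorm (z i.+1))%R)%N.

(* A step parameter that stays constant once the tolerance test fails cannot
   itself tend to [al], nor satisfy [P2] across a stall.  So "update according
   to P1 and P2" means: move to the next term of a sequence [a] satisfying [P1]
   and [P2]; the step parameter at iteration [k] is the term of [a] indexed by
   the number of updates made so far.  The updates of [delta] and [rho] follow
   those of [alpha] through [P4] and [P5]. *)
Record adaptive_DPFS (R : realType) (n p s : nat) (S : set 'cV[R]_n)
  (f : 'cV[R]_p -> \bar R) (g : 'cV[R]_s -> \bar R)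
  (A : 'M[R]_(s, n)) (K : 'M[R]_(p, n)) (vphi : 'cV[R]_n -> R)
  (gamma al eps : R) (a alpha beta delta rho : nat -> R)
  (x : nat -> 'cV[R]_n) (y : nat -> 'cV[R]_p) (z : nat -> 'cV[R]_s) : Prop :=
  AdaptiveDPFS {
    dpfs_x : forall k, proj S
      (x k + (rho k)^-1 *:
         (- gradient vphi (x k) + K^T *m y k - A^T *m z k)) (x k.+1);
    dpfs_y : forall k, prox (conjugate f) (beta k)^-1
      (y k + (beta k)^-1 *: (K *m x k.+1)) (y k.+1);
    dpfs_z : forall k, prox (conjugate g) (alpha k)^-1
      (delta k *: z k + (alpha k)^-1 *: (A *m x k.+1)) (z k.+1);
    dpfs_alpha0 : alpha 0%N = al + gamma;
    dpfs_alpha : forall k, alpha k = a (nb_updates al eps alpha z k)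
  }.

(* Main.v *)
Require Import Defs.
From HB Require Import structures.
From mathcomp Require Import all_boot all_order all_algebra.
From mathcomp Require Import all_classical all_reals all_analysis.
From mathcomp Require Import ring lra zify.

Set Implicit Arguments.
Unset Strict Implicit.
Unset Printing Implicit Defensive.

Import Order.TTheory GRing.Theory Num.Theory.
Import numFieldNormedType.Exports.

Local Open Scope classical_set_scope.
Local Open Scope ring_scope.

(* Once the parameters are frozen, Moreau's decomposition turns the proximal steps
   into subgradient relations: [y_(k+1)] is a subgradient of [f] at
   [eta = K x_(k+1) + beta_k (y_k - y_(k+1))], and [z_(k+1)] one of [g] at
   [xi = A x_(k+1) + al z_k - alt z_(k+1)].  Combined with the projection inequality,
   the descent lemma for [vphi] and the monotonicity of the subdifferential of
   [g^*], these show that the merit function decreases along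
   [w_k = (x_(k+1), y_(k+1), z_(k+1), z_k)] by at least [c1 * D_k ^+ 2], where [D_k] is
   the length of the step.  Essential strict convexity of [g] makes [g^*]
   differentiable at [z_(k+1)], so the same relations exhibit a Frechet subgradient
   of the merit function at [w_k] of norm at most [C * D_k].  At the limit point the
   KL inequality then gives [E_k `^ theta <= C' * D_k] for the gap
   [E_k] to the limit value, and the rates follow from the scalar recursion
   [E_(k+1) + c1 * D_(k+1) ^+ 2 <= E_k]. *)

(** The merit function contains [- conjugate g], which is concave, and this shapes the proof twice.
    In the descent, the new value of [- conjugate g] has to be bounded by a subgradient taken at the
    old point, so the relation of the previous iteration enters and leaves a cross term with z_k -
    z_(k-1); the term in |z - u|^2 is there to absorb it. For the subgradients, the supporting
    inequality of [conjugate g] points the wrong way, so a first-order upper expansion is proved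
    instead, and Frechet subgradients of the whole merit function are verified by direct estimates,
    without a calculus of limiting subdifferentials. Convergence of the iterates puts them
    eventually in the KL neighbourhood, but convergence of the merit values is a separate matter,
    the conjugates being only lower semicontinuous; convergent subgradients settle it. For the
    rates, each step bound takes the form D_(k+1) <= P_k - P_(k+1), so that P_k bounds the distance
    to the limit. For theta > 1/2, summing the bound D <= sqrt(E / c1) would lose part of the
    exponent or even diverge; the potential P_k = D_k + B E_k^(1 - theta) avoids this. *)

Section Euclidean.
Context {R : realType}.

(** * Euclidean geometry and its agreement with the topology of the sup norm *)

Section dot.
Context {d : nat}.
Implicit Types x y z : 'cV[R]_d.

Lemma dotC x y : dot x y = dot y x.
Proof. by apply: eq_bigr => i _; rewrite mulrC. Qed.

Lemma dotDl x y z : dot (x + y) z = dot x z + dot y z.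
Proof. by rewrite -big_split; apply: eq_bigr => i _; rewrite mxE mulrDl. Qed.

Lemma dotZl t x y : dot (t *: x) y = t * dot x y.
Proof. by rewrite /dot big_distrr; apply: eq_bigr => i _; rewrite mxE -mulrA. Qed.

Lemma dotNl x y : dot (- x) y = - dot x y.
Proof. by rewrite -scaleN1r dotZl mulN1r. Qed.

Lemma dotDr x y z : dot x (y + z) = dot x y + dot x z.
Proof. by rewrite dotC dotDl !(dotC x). Qed.

Lemma dotZr t x y : dot x (t *: y) = t * dot x y.
Proof. by rewrite dotC dotZl dotC. Qed.

Lemma dotNr x y : dot x (- y) = - dot x y.
Proof. by rewrite dotC dotNl dotC. Qed.

Lemma dot0r x : dot x 0 = 0.
Proof. by rewrite -(scale0r x) dotZr mul0r. Qed.

Lemma dotxx_ge0 x : 0 <= dot x x.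
Proof. by apply: sumr_ge0 => i _; rewrite -expr2 sqr_ge0. Qed.

Definition dotE := (dotDl, dotDr, dotZl, dotZr, dotNl, dotNr).

Lemma enorm_ge0 x : 0 <= enorm x.
Proof. exact: sqrtr_ge0. Qed.

Lemma sqr_enorm x : enorm x ^+ 2 = dot x x.
Proof. by rewrite sqr_sqrtr ?dotxx_ge0. Qed.

Lemma enormZ t x : enorm (t *: x) = `|t| * enorm x.
Proof.
by rewrite /enorm dotZl dotZr mulrA -expr2 sqrtrM ?sqr_ge0// sqrtr_sqr.
Qed.

Lemma enormN x : enorm (- x) = enorm x.
Proof. by rewrite -scaleN1r enormZ normrN normr1 mul1r. Qed.

Lemma enormB x y : enorm (x - y) = enorm (y - x).
Proof. by rewrite -opprB enormN. Qed.

Lemma enorm0 : enorm (0 : 'cV[R]_d) = 0.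
Proof. by rewrite -(scale0r 0) enormZ normr0 mul0r. Qed.

Lemma coord_le_enorm x i : `|x i 0| <= enorm x.
Proof.
rewrite -(ler_pXn2r (n := 2)) ?nnegrE ?enorm_ge0// sqr_enorm real_normK ?num_real//.
rewrite /dot (bigD1 i)//= -expr2 lerDl.
by apply: sumr_ge0 => j _; rewrite -expr2 sqr_ge0.
Qed.

Lemma enorm_eq0 x : enorm x = 0 -> x = 0.
Proof.
move=> x0; apply/matrixP => i j; rewrite ord1 mxE.
by apply/eqP; rewrite -normr_le0 -x0 coord_le_enorm.
Qed.

Lemma enorm_gt0 x : x <> 0 -> 0 < enorm x.
Proof.
by move=> x0; rewrite lt_neqAle enorm_ge0 andbT eq_sym; apply/eqP => /enorm_eq0.
Qed.

Lemma CauchySchwarz_dot x y : dot x y <= enorm x * enorm y.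
Proof.
have [/enorm_eq0 ->|x0] := eqVneq (enorm x) 0.
  by rewrite dotC dot0r mulr_ge0 ?enorm_ge0.
have [/enorm_eq0 ->|y0] := eqVneq (enorm y) 0.
  by rewrite dot0r mulr_ge0 ?enorm_ge0.
have xy0 : 0 < enorm x * enorm y.
  by rewrite mulr_gt0 // lt_neqAle eq_sym ?x0 ?y0 enorm_ge0.
have := dotxx_ge0 (enorm y *: x - enorm x *: y).
rewrite !dotE -!sqr_enorm (dotC y x) => h.
rewrite -(ler_pM2l xy0); nra.
Qed.

Lemma abs_dot_le x y : `|dot x y| <= enorm x * enorm y.
Proof.
by rewrite ler_norml CauchySchwarz_dot andbT lerNl -dotNl -(enormN x)
  CauchySchwarz_dot.
Qed.

Lemma enormD_le x y : enorm (x + y) <= enorm x + enorm y.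
Proof.
rewrite -(ler_pXn2r (n := 2)) ?nnegrE ?addr_ge0 ?enorm_ge0//.
rewrite sqrrD !sqr_enorm !dotE (dotC y x); have := CauchySchwarz_dot x y; lra.
Qed.

Lemma enormB_le x y : enorm (x - y) <= enorm x + enorm y.
Proof. by rewrite -(enormN y) enormD_le. Qed.

Lemma enorm_dist_triangle x y z : enorm (x - z) <= enorm (x - y) + enorm (y - z).
Proof. by have := enormD_le (x - y) (y - z); rewrite addrA subrK. Qed.

Lemma norm_le_enorm x : `|x| <= enorm x.
Proof.
rewrite [leLHS]mx_normrE; apply/bigmax_leP; split; first exact: enorm_ge0.
by move=> [i j] _ /=; rewrite ord1 coord_le_enorm.
Qed.

(** The factor is crude, but [d.+1] is positive also for [d = 0], so that neighbourhoods can be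
    compared by dividing by it. *)
Lemma enorm_le_norm x : enorm x <= d.+1%:R * `|x|.
Proof.
rewrite -(ler_pXn2r (n := 2)) ?nnegrE ?enorm_ge0 ?mulr_ge0// sqr_enorm.
have xi i : x i 0 * x i 0 <= `|x| ^+ 2.
  rewrite -expr2 -(real_normK (num_real (x i 0))) ler_pXn2r ?nnegrE//.
  by rewrite [leRHS]mx_normrE; apply/bigmax_geP; right; exists (i, 0).
apply: (@le_trans _ _ (\sum_(i < d) `|x| ^+ 2)); first exact: ler_sum.
rewrite sumr_const card_ord exprMn -[leLHS]mulr_natl ler_wpM2r ?sqr_ge0//.
by rewrite -natrX ler_nat (leq_trans (leqnSn d))// leq_pmulr.
Qed.

Lemma nbhs_enormP x (U : set 'cV[R]_d) :
  nbhs x U <-> exists2 e : R, 0 < e & forall y, enorm (y - x) < e -> U y.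
Proof.
split=> [/nbhs_normP[e /= e0 h]|[e e0 h]].
  exists e => // y yx; apply: h => /=.
  by rewrite /= distrC (le_lt_trans (norm_le_enorm _)).
apply/nbhs_ballP; exists (e / d.+1%:R) => /=; first by rewrite divr_gt0.
move=> y; rewrite -ball_normE /= => xy; apply: h; rewrite enormB (le_lt_trans (enorm_le_norm _))//.
by rewrite mulrC -ltr_pdivlMr.
Qed.

Lemma cvg_enormP (x_ : nat -> 'cV[R]_d) x :
  x_ @ \oo --> x <-> (fun k => enorm (x_ k - x)) @ \oo --> (0 : R).
Proof.
split=> [h|h].
  apply/cvgr0Pnorm_lt => e e0.
  have : \forall k \near \oo, enorm (x_ k - x) < e.
    apply: (h [set y | enorm (y - x) < e]).
    by apply/nbhs_enormP; exists e.
  by apply: filterS => k /= hk; rewrite ger0_norm ?enorm_ge0.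
move=> U /nbhs_enormP[e e0 hU].
have : \forall k \near \oo, `|enorm (x_ k - x)| < e by exact: (cvgr0Pnorm_lt _).1 h _ e0.
by apply: filterS => k; rewrite ger0_norm ?enorm_ge0// => /hU.
Qed.

Lemma cvg_dot (x_ y_ : nat -> 'cV[R]_d) x y : x_ @ \oo --> x ->
  y_ @ \oo --> y -> (fun k => dot (x_ k) (y_ k)) @ \oo --> dot x y.
Proof.
move=> xx yy; apply: cvg_big => [|i _]; first exact: add_continuous.
have coord (v_ : nat -> 'cV[R]_d) (v : 'cV[R]_d) : v_ @ \oo --> v ->
    (fun k => v_ k i 0) @ \oo --> v i 0.
  by move=> vv; exact: (cvg_comp _ _ vv (@coord_continuous _ _ _ i 0 v)).
by apply: cvgM; exact: coord.
Qed.

Lemma continuous_dotr x : continuous (dot x).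
Proof.
move=> y; apply/(@cvgrPdist_lt _ _ _ _ (nbhs_filter y)) => e e0; have x1 : 0 < enorm x + 1.
  by rewrite ltr_wpDl ?enorm_ge0.
apply/nbhs_enormP; exists (e / (enorm x + 1)) => [|w /=]; first exact: divr_gt0.
rewrite ltr_pdivlMr// => yw; rewrite -dotNr -dotDr (le_lt_trans (abs_dot_le _ _))//.
by rewrite enormB; have := enorm_ge0 (w - y); lra.
Qed.

Lemma continuous_enormB q : continuous (fun x => enorm (x - q)).
Proof.
move=> x; apply/(@cvgrPdist_lt _ _ _ _ (nbhs_filter x)) => e e0; apply/nbhs_enormP; exists e => // y yx.
rewrite /= ltr_norml; apply/andP; split.
  by have := enorm_dist_triangle y x q; lra.
by have := enorm_dist_triangle x y q; rewrite (enormB x y); lra.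
Qed.

Lemma continuous_trmx : continuous (@trmx R 1 d).
Proof.
move=> v; apply/(@cvgrPdist_lt _ _ _ _ (nbhs_filter v)) => e e0; apply/nbhs_ballP; exists e => //= w.
rewrite -ball_normE /= -linearB/=; apply: le_lt_trans.
rewrite [leLHS]mx_normrE; apply/bigmax_leP; split=> // -[i j] _ /=.
rewrite [leRHS]mx_normrE; apply/bigmax_geP; right; exists (j, i) => //=.
by rewrite !mxE.
Qed.

(** Heine-Borel: a closed subset of a box, the box being the transpose of a product of segments in
    row vectors, which is compact by [rV_compact]. *)
Lemma compact_enorm_bounded (A : set 'cV[R]_d) q M :
  closed A -> (forall x, A x -> enorm (x - q) <= M) -> compact A.
Proof.
move=> Acl AM; pose I i : set R := `[q i 0 - M, q i 0 + M]%classic.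
have cB : compact [set v : 'rV[R]_d | forall i, I i (v ord0 i)].
  by apply: rV_compact => i; exact: segment_compact.
have /subclosed_compact : compact (trmx @` [set v : 'rV[R]_d | forall i, I i (v ord0 i)]).
  by apply: continuous_compact cB; apply: continuous_subspaceT; exact: continuous_trmx.
apply=> // x /AM xM; exists x^T; last by rewrite trmxK.
move=> i; rewrite /I/= in_itv/= mxE.
by have := le_trans (coord_le_enorm (x - q) i) xM; rewrite !mxE ler_norml; lra.
Qed.

End dot.

Section matrices.
Context {m d : nat}.
Variable A : 'M[R]_(m, d).

Lemma dot_mulmxl (x : 'cV[R]_d) (y : 'cV[R]_m) : dot (A *m x) y = dot x (A^T *m y).
Proof.
rewrite /dot; under eq_bigr do rewrite mxE big_distrl/=.
rewrite exchange_big/=; apply: eq_bigr => j _; rewrite mxE big_distrr/=.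
by apply: eq_bigr => i _; rewrite mxE mulrAC mulrC mulrA.
Qed.

(** [opnorm] is a [sup], informative only for a set that is bounded above. This entrywise bound
    supplies the boundedness, and serves wherever the value of the constant is immaterial. *)
Lemma enorm_mulmx_bounded :
  exists2 C, 0 <= C & forall x : 'cV[R]_d, enorm (A *m x) <= C * enorm x.
Proof.
exists (m.+1%:R * \sum_i \sum_j `|A i j|) => [|x].
  by rewrite mulr_ge0// sumr_ge0// => i _; rewrite sumr_ge0.
rewrite (le_trans (enorm_le_norm _))// -mulrA ler_wpM2l//.
rewrite [leLHS]mx_normrE; apply/bigmax_leP; split.
  by rewrite mulr_ge0 ?enorm_ge0// sumr_ge0// => i _; rewrite sumr_ge0.
move=> [i j] _ /=; rewrite mxE (le_trans (ler_norm_sum _ _ _))//.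
rewrite (bigD1 i)//= mulrDl -[leLHS]addr0 lerD//; last first.
  by rewrite mulr_ge0 ?enorm_ge0// sumr_ge0// => k _; rewrite sumr_ge0.
rewrite mulr_suml ler_sum// => k _.
by rewrite normrM ler_wpM2l// ord1 coord_le_enorm.
Qed.

Lemma enorm_mulmx_le (x : 'cV[R]_d) : enorm (A *m x) <= opnorm A * enorm x.
Proof.
have [C C0 hC] := enorm_mulmx_bounded.
have [/enorm_eq0 ->|x0] := eqVneq (enorm x) 0.
  by rewrite mulmx0 !enorm0 mulr0.
have {}x0 : 0 < enorm x by rewrite lt_neqAle eq_sym x0 enorm_ge0.
rewrite -ler_pdivrMr//.
have <- : enorm (A *m ((enorm x)^-1 *: x)) = enorm (A *m x) / enorm x.
  by rewrite -scalemxAr enormZ ger0_norm ?invr_ge0 ?enorm_ge0// mulrC.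
apply: ub_le_sup.
  exists C => _ [y /= y1 <-]; rewrite (le_trans (hC y))//.
  by rewrite -[leRHS]mulr1 ler_wpM2l.
exists ((enorm x)^-1 *: x) => //=.
by rewrite enormZ ger0_norm ?invr_ge0 ?enorm_ge0// mulVf// gt_eqF.
Qed.

Lemma cvg_mulmx (x_ : nat -> 'cV[R]_d) x :
  x_ @ \oo --> x -> (fun k => A *m x_ k) @ \oo --> A *m x.
Proof.
move=> /cvg_enormP h; apply/cvg_enormP.
have [C C0 hC] := enorm_mulmx_bounded.
apply: (@squeeze_cvgr _ _ _ _ (fun=> 0) (fun k => C * enorm (x_ k - x))).
- by near=> k; rewrite enorm_ge0/= -mulmxBr hC.
- exact: cvg_cst.
- by rewrite -[X in _ --> X](mulr0 C); apply: cvgM => //; exact: cvg_cst.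
Unshelve. all: end_near. Qed.

End matrices.

End Euclidean.

(** * Lower semicontinuous convex functions: bounds on compact sets and proximal optimality *)

Section ConvexAnalysis.
Context {R : realType} {d : nat}.
Implicit Types (h : 'cV[R]_d -> \bar R) (x y v w q xi z : 'cV[R]_d).

(** Finiteness of [h x] is part of the notion and its value is kept as a real, so that no difference
    of extended reals occurs. *)
Definition subgradient h x v :=
  exists2 r : R, h x = r%:E & forall u, ((r + dot v (u - x))%:E <= h u)%E.

Lemma lt_EFin_dense (a : R) (t : \bar R) :
  (a%:E < t)%E -> exists2 b : R, a < b & (b%:E < t)%E.
Proof.
case: t => [t| |]//; rewrite ?lte_fin => at_.
  by exists ((a + t) / 2); rewrite ?lte_fin; lra.
by exists (a + 1); rewrite ?ltry// ltrDl.
Qed.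

(** Near each point the strict inequality survives with a small [e]; the covering form of
    compactness makes one [e] serve all of [C]. This gives both the existence of proximal minimisers
    and the margin on a sphere used for the conjugate. *)
Lemma lsc_compact_margin h (l : 'cV[R]_d -> R) (C : set 'cV[R]_d) :
  lower_semicontinuous h -> continuous l -> compact C ->
  (forall x, C x -> ((l x)%:E < h x)%E) ->
  exists2 e : R, 0 < e & forall x, C x -> ((l x + e)%:E <= h x)%E.
Proof.
move=> hlsc lcont /compact_near_coveringP Ccov lh.
have Cmargin : \forall e \near (0:R)^'+, C `<=` (fun x => (l x + e)%:E < h x)%E.
  apply: Ccov => x /lh /lt_EFin_dense[b lb bh].
  have [V Vx Vh] := hlsc _ _ bh.
  have lx : \forall y \near x, l y < (l x + b) / 2.
    by apply: (cvgr_lt _ (lcont x)); lra.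
  near=> y e => /=; apply: (@lt_trans _ _ b%:E); last first.
    by apply: Vh; near: y.
  have ly : l y < (l x + b) / 2 by near: y.
  have : e < (b - l x) / 2 by near: e; apply: nbhs_right_lt; lra.
  by rewrite lte_fin; lra.
have [e [e0 eC]] : exists e : R, 0 < e /\ C `<=` (fun x => (l x + e)%:E < h x)%E.
  near (0:R)^'+ => e; exists e; split; last by near: e.
  by near: e; exact: nbhs_right_gt.
by exists e => // x /eC/ltW.
Unshelve. all: end_near. Qed.

Lemma lsc_compact_lbound h (C : set 'cV[R]_d) : lower_semicontinuous h ->
  (forall x, (-oo < h x)%E) -> compact C ->
  exists m : R, forall x, C x -> (m%:E <= h x)%E.
Proof.
move=> hlsc hNy /compact_near_coveringP Ccov.
have Clb : \forall M \near (+oo_R : set_system R), C `<=` (fun x => (- M)%:E < h x)%E.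
  apply: Ccov => x _.
  have [b bh] : exists b : R, (b%:E < h x)%E.
    case: (h x) (hNy x) => [t| |]// _; last by exists 0; rewrite ltry.
    by exists (t - 1); rewrite lte_fin; lra.
  have [V Vx Vh] := hlsc _ _ bh.
  near=> y M => /=; apply: (@le_lt_trans _ _ b%:E); last by apply: Vh; near: y.
  by rewrite lee_fin lerNl; near: M; apply: nbhs_pinfty_ge; exact: num_real.
have [M MC] : exists M : R, C `<=` (fun x => (- M)%:E < h x)%E.
  by near (+oo_R : set_system R) => M; exists M; near: M.
by exists (- M) => x /MC/ltW.
Unshelve. all: end_near. Qed.

Lemma closed_enorm_ball q M : closed [set x | enorm (x - q) <= M].
Proof.
have -> : [set x | enorm (x - q) <= M] = (fun x => enorm (x - q)) @^-1` [set t | t <= M].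
  by [].
apply: preimage_closed; first by move=> ? _; exact: continuous_enormB.
exact: closed_le.
Qed.

Lemma compact_enorm_ball q M : compact [set x | enorm (x - q) <= M].
Proof. by apply: compact_enorm_bounded (@closed_enorm_ball q M) _ => x; exact. Qed.

Lemma compact_enorm_sphere q M : compact [set x | enorm (x - q) = M].
Proof.
apply: (@compact_enorm_bounded _ _ _ q M); last by move=> x /= ->.
have -> : [set x | enorm (x - q) = M] = (fun x => enorm (x - q)) @^-1` [set M].
  by [].
apply: preimage_closed; first by move=> ? _; exact: continuous_enormB.
exact: closed_eq.
Qed.

(** Beyond the unit ball around [w0], the point at distance 1 on the segment from [w0] to [w] has
    value at least [m]; convexity turns this into a lower bound at [w] that is affine in the
    distance. *)
Lemma convex_affine_minorant h w0 (r0 : R) : econvex h -> lower_semicontinuous h ->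
  (forall x, (-oo < h x)%E) -> h w0 = r0%:E ->
  exists a b : R, 0 <= a /\ forall w, ((b - a * enorm (w - w0))%:E <= h w)%E.
Proof.
move=> hconv hlsc hNy hw0.
have [m mh] := lsc_compact_lbound hlsc hNy (@compact_enorm_ball w0 1).
have mr0 : m <= r0.
  by rewrite -lee_fin -hw0; apply: mh; rewrite /= subrr enorm0.
exists (r0 - m), m; split=> [|w]; first by lra.
have N0 := enorm_ge0 (w - w0); set N := enorm _ in N0 *.
have [N1|N1] := leP N 1.
  by apply: le_trans (mh _ N1); rewrite lee_fin; nra.
have V01 : 0 <= N^-1 <= 1 by rewrite invr_ge0 N0/= invf_le1; lra.
have NV : N * N^-1 = 1 by rewrite mulfV// gt_eqF//; lra.
have hp := hconv w w0 N^-1 V01.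
have /mh hm : enorm (N^-1 *: w + (1 - N^-1) *: w0 - w0) <= 1.
  have -> : N^-1 *: w + (1 - N^-1) *: w0 - w0 = N^-1 *: (w - w0).
    by rewrite scalerBr scalerBl scale1r addrA addrAC addrK.
  by rewrite enormZ ger0_norm -/N ?invr_ge0// mulVf// gt_eqF//; lra.
have := le_trans hm hp; rewrite hw0.
case: (h w) (hNy w) => [t _| |]//; last by rewrite leey.
rewrite -!EFinM -EFinD !lee_fin => /(ler_wpM2l N0).
have -> : N * (N^-1 * t + (1 - N^-1) * r0) = t + (N - 1) * r0 by ring: NV.
lra.
Qed.

Lemma subgradient_finite h x v : subgradient h x v -> h x \is a fin_num.
Proof. by move=> [r ->]. Qed.

(** Comparing [xi] with [s *: u + (1 - s) *: xi] and dividing by [s] gives the subgradient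
    inequality up to an error proportional to [s]. *)
Lemma prox_optimality h c q xi (r : R) : 0 < c -> econvex h ->
  (forall x, (-oo < h x)%E) -> h xi = r%:E ->
  (forall w, ((r + c / 2 * enorm (xi - q) ^+ 2)%:E
     <= h w + (c / 2 * enorm (w - q) ^+ 2)%:E)%E) ->
  subgradient h xi (c *: (q - xi)).
Proof.
move=> c0 hconv hNy hxi ximin; exists r => // u.
case hu : (h u) (hNy u) => [t| |]// _; last by rewrite leey.
rewrite lee_fin; apply/ler_addgt0Pr => e e0.
set B := dot (u - xi) (u - xi); have B0 : 0 <= B by exact: dotxx_ge0.
(* Takes the place of a limit [s -> 0]: this [s] is at most 1 and makes the quadratic remainder
   [s * (c * B)] at most [e], also when [B = 0]. *)
pose s := e / (e + c * B).
have D0 : 0 < e + c * B by nra.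
have s0 : 0 < s by rewrite divr_gt0.
have s1 : s <= 1 by rewrite ler_pdivrMr//; nra.
have s01 : 0 <= s <= 1 by lra.
have sB : s * (c * B) <= e.
  by rewrite mulrAC ler_pdivrMr//; nra.
have hsu := hconv u xi s s01.
have := ximin (s *: u + (1 - s) *: xi).
move: hsu; rewrite hu hxi; case: (h _) (hNy (s *: u + (1 - s) *: xi)) => [k _| |]//.
rewrite -!EFinM -!EFinD !lee_fin.
have -> : s *: u + (1 - s) *: xi - q = s *: (u - xi) + (xi - q).
  by apply/matrixP => i j; rewrite !mxE; ring.
rewrite !sqr_enorm !dotE (dotC q u) (dotC q xi) (dotC xi u) => k1 k2.
move: sB; rewrite /B !dotE (dotC xi u) => sB.
rewrite -(ler_pM2l s0); nra.
Qed.

End ConvexAnalysis.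

(** * Fenchel conjugates: proximal points, closed graph, first-order expansion *)

Section Conjugate.
Context {R : realType} {d : nat}.
Implicit Types (h : 'cV[R]_d -> \bar R) (x y v w q xi z : 'cV[R]_d).

(** [xi] minimises [h] plus the quadratic. The minorant of [h] confines the search to a ball; there
    the infimum is attained, since otherwise [lsc_compact_margin] would raise it. *)
Lemma prox_subgradient_exists h c q : 0 < c -> eproper h -> econvex h ->
  lower_semicontinuous h -> exists xi, subgradient h xi (c *: (q - xi)).
Proof.
move=> c0 [hNy [w0 w0dom]] hconv hlsc.
have [r0 hw0] : exists r0 : R, h w0 = r0%:E.
  by move: w0dom (hNy w0); rewrite /edom/=; case: (h w0) => // t; exists t.
have [a [b [a0 hmin]]] := convex_affine_minorant hconv hlsc hNy hw0.
pose psi w := c / 2 * enorm (w - q) ^+ 2.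
have psi0 w : 0 <= psi w by rewrite /psi mulr_ge0 ?sqr_ge0//; lra.
set e := enorm (w0 - q); have e0 : 0 <= e by exact: enorm_ge0.
(* Beyond this radius the growth of the quadratic outweighs the shift [e] of its centre, the slope
   [a] of the minorant and the gap [r0 - b], so the objective is at least its value at [w0]. *)
pose M := 1 + (e * c + a + `|r0 - b|) / (c / 2).
have num0 : 0 <= e * c + a + `|r0 - b| by rewrite !addr_ge0// mulr_ge0// ltW.
have M0 : 0 <= M by rewrite /M addr_ge0// divr_ge0//; lra.
pose C := [set w | enorm (w - w0) <= M].
have Cc : compact C by exact: compact_enorm_ball.
have Cw0 : C w0 by rewrite /C/= subrr enorm0.
pose X := [set t : R | exists2 w, C w & h w = (t - psi w)%:E].
have [m mh] := lsc_compact_lbound hlsc hNy Cc.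
have Xinf : has_inf X.
  split; first by exists (r0 + psi w0), w0 => //; rewrite addrK.
  exists m => t [w Cw hw]; have := mh _ Cw; rewrite hw lee_fin.
  by have := psi0 w; lra.
have [xi [Cxi xim]] : exists xi, C xi /\ (h xi <= (inf X - psi xi)%:E)%E.
  apply: contrapT => nxi.
  have hgt w : C w -> ((inf X - psi w)%:E < h w)%E.
    by move=> Cw; rewrite ltNge; apply/negP => hw; apply: nxi; exists w.
  have psic : continuous (fun w => inf X - psi w).
    move=> w; have wq := @continuous_enormB _ _ q w.
    exact: (cvgB (cvg_cst _) (cvgM (cvg_cst _) (cvgM wq wq))).
  have [del del0 hdel] := lsc_compact_margin hlsc psic Cc hgt.
  have [t [w Cw hw] tX] := inf_adherent del0 Xinf.
  by have := hdel _ Cw; rewrite hw lee_fin; lra.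
have [r hxi] : exists r : R, h xi = r%:E.
  by move: xim (hNy xi); case: (h xi) => // t; exists t.
exists xi; apply: (prox_optimality c0 hconv hNy hxi) => w.
move: xim; rewrite hxi lee_fin => rX.
have XC t : X t -> inf X <= t by apply: ge_inf; case: Xinf.
have Xr0 : inf X <= r0 + psi w0 by apply: XC; exists w0 => //; rewrite addrK.
case hw : (h w) (hNy w) => [t| |]// _; last by rewrite addye ?leey.
rewrite -EFinD lee_fin.
have [wM|wM] := leP (enorm (w - w0)) M.
  suff : inf X <= t + psi w by rewrite -/(psi w) -/(psi xi); lra.
  by apply: XC; exists w => //; rewrite addrK.
have := hmin w; rewrite hw lee_fin -/(psi w) -/(psi xi).
move: wM; set N := enorm (w - w0) => wM tN.
suff : r0 + psi w0 <= t + psi w by lra.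
have wq : N - e <= enorm (w - q).
  by have := enorm_dist_triangle w q w0; rewrite (enormB q w0) -/N -/e; lra.
have wq2 : N ^+ 2 - 2 * N * e + e ^+ 2 <= enorm (w - q) ^+ 2.
  have -> : N ^+ 2 - 2 * N * e + e ^+ 2 = (N - e) ^+ 2 by ring.
  rewrite -[leLHS]real_normK ?num_real// ler_pXn2r ?nnegrE ?enorm_ge0// ler_norml.
  rewrite wq andbT lerNl opprB.
  by have := enorm_dist_triangle w0 w q; rewrite (enormB w0 w) -/N -/e; lra.
have cM : c / 2 * M = c / 2 + (e * c + a + `|r0 - b|).
  by rewrite /M mulrDr mulr1 mulrCA mulfV ?mulr1// gt_eqF//; lra.
have N1 : 1 <= N.
  apply: le_trans (ltW wM); rewrite /M lerDl divr_ge0//; lra.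
have rb : r0 - b <= `|r0 - b| by exact: ler_norm.
have rb0 : 0 <= `|r0 - b| by [].
have cN : c / 2 + (e * c + a + `|r0 - b|) <= c / 2 * N by nra.
have cN2 : N * (c / 2 + (e * c + a + `|r0 - b|)) <= c / 2 * N ^+ 2.
  by rewrite expr2 mulrA [leRHS]mulrC ler_wpM2l//; lra.
have rbN : `|r0 - b| <= N * `|r0 - b| by rewrite ler_peMl.
have : c / 2 * (N ^+ 2 - 2 * N * e + e ^+ 2) <= psi w.
  by rewrite /psi ler_wpM2l//; lra.
by rewrite {2}/psi -/e; nra.
Qed.

Lemma conjugate_ge h w (r : R) z :
  h w = r%:E -> ((dot z w - r)%:E <= conjugate h z)%E.
Proof. by move=> hw; apply: ereal_sup_ubound; exists w => //; rewrite hw. Qed.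

Lemma conjugate_gtNy h z : eproper h -> (-oo < conjugate h z)%E.
Proof.
move=> [hNy [w wdom]].
have [r hw] : exists r : R, h w = r%:E.
  by move: wdom (hNy w); rewrite /edom/=; case: (h w) => // t; exists t.
exact: lt_le_trans (ltNyr _) (conjugate_ge z hw).
Qed.

Lemma conjugate_le h z (t : R) : (forall u, ((dot z u - t)%:E <= h u)%E) ->
  (conjugate h z <= t%:E)%E.
Proof.
move=> hu; apply: ge_ereal_sup => _ [u _ <-] /=; move: (hu u).
case: (h u) => [k| |]//; last by move=> _; exact: leNye.
by rewrite -EFinB !lee_fin; lra.
Qed.

Lemma conjugate_subgradient h xi z (r : R) : h xi = r%:E ->
  subgradient h xi z -> conjugate h z = (dot z xi - r)%:E.
Proof.
move=> hxi [r']; rewrite hxi => -[<-] hu.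
apply/eqP; rewrite eq_le conjugate_ge// andbT; apply: conjugate_le => u.
by apply: le_trans (hu u); rewrite lee_fin !dotE; lra.
Qed.

Lemma subgradient_conjugate h xi z :
  subgradient h xi z -> subgradient (conjugate h) z xi.
Proof.
move=> hs; have [r hxi hu] := hs; exists (dot z xi - r).
  exact: conjugate_subgradient.
move=> u; apply: le_trans (conjugate_ge u hxi).
by rewrite lee_fin !dotE (dotC xi u) (dotC xi z); lra.
Qed.

(** The subgradient inequality tested at [zp], added to the minimality of [zp] tested at [z], leaves
    [c / 2 * enorm (zp - z) ^+ 2 <= 0]. *)
Lemma prox_subgradient_unique h c q z zp : 0 < c ->
  subgradient h z (c *: (q - z)) -> prox h c^-1 q zp -> zp = z.
Proof.
move=> c0 [r hz hu] /(_ z); have := hu zp; rewrite hz.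
have -> : (2 * c^-1)^-1 = c / 2 by rewrite invfM invrK mulrC.
case: (h zp) => [t| |]//; rewrite -!EFinD !lee_fin.
have -> : zp - q = (zp - z) - (q - z) by rewrite opprB addrA subrK.
rewrite -(enormB q z) !sqr_enorm dotZl.
move: (q - z) => Q h1 h2; apply/subr0_eq; move: (zp - z) h1 h2 => D.
rewrite !dotE (dotC D Q) => h1 h2; apply: enorm_eq0; apply/eqP.
rewrite -sqrf_eq0 sqr_enorm eq_le dotxx_ge0 andbT -(ler_pM2l c0) mulr0; lra.
Qed.

(* Moreau's decomposition: the candidate dual point comes from minimising
   [h] plus a quadratic, so no biconjugation theorem is needed. *)
Lemma prox_conjugate_subgradient h c q zp : 0 < c -> eproper h -> econvex h ->
  lower_semicontinuous h -> prox (conjugate h) c^-1 q zp ->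
  subgradient h (c *: (q - zp)) zp.
Proof.
move=> c0 hp hconv hlsc hprox.
have V0 : 0 < c^-1 by rewrite invr_gt0.
have [xi hxi] := prox_subgradient_exists (c *: q) V0 hp hconv hlsc.
set z := c^-1 *: (c *: q - xi) in hxi.
have zE : xi = c *: (q - z).
  by apply/matrixP => i j; rewrite !mxE; field; rewrite gt_eqF.
have hz : subgradient (conjugate h) z (c *: (q - z)).
  by rewrite -zE; exact: subgradient_conjugate.
by rewrite (prox_subgradient_unique c0 hz hprox) -zE.
Qed.

(** By lower semicontinuity, [h xi] is at most the limit of the bounds
    [h u - dot (z_ k) (u - xi_ k)] on [h (xi_ k)]; a point [u] of the domain makes [h xi] finite. *)
Lemma subgradient_closed h (xi_ z_ : nat -> 'cV[R]_d) xi z N : eproper h ->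
  lower_semicontinuous h -> xi_ @ \oo --> xi -> z_ @ \oo --> z ->
  (forall k, (N <= k)%N -> subgradient h (xi_ k) (z_ k)) -> subgradient h xi z.
Proof.
move=> [hNy [u0 u0dom]] hlsc xixi zz hk.
have key u (t : R) : h u = t%:E -> (h xi <= (t - dot z (u - xi))%:E)%E.
  move=> hu; rewrite leNgt; apply/negP => /lt_EFin_dense[b lb bh].
  have [V Vxi Vh] := hlsc _ _ bh.
  have dk : (fun k => dot (z_ k) (u - xi_ k)) @ \oo --> dot z (u - xi).
    by apply: cvg_dot => //; apply: cvgB => //; exact: cvg_cst.
  have dlt : \forall k \near \oo, t - b < dot (z_ k) (u - xi_ k).
    by apply: (cvgr_gt _ dk); lra.
  near \oo => k.
  have [r hr] : subgradient h (xi_ k) (z_ k) by apply: hk; near: k; exact: nbhs_infty_ge.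
  move=> /(_ u); rewrite hu lee_fin.
  have : (b%:E < h (xi_ k))%E by apply: Vh; near: k; exact: xixi.
  rewrite hr lte_fin.
  have : t - b < dot (z_ k) (u - xi_ k) by near: k.
  lra.
have [t0 hu0] : exists r : R, h u0 = r%:E.
  by move: u0dom (hNy u0); rewrite /edom/=; case: (h u0) => // t; exists t.
have [r hxi] : exists r : R, h xi = r%:E.
  by move: (key _ _ hu0) (hNy xi); case: (h xi) => // t; exists t.
exists r => // u; case hu : (h u) (hNy u) => [t| |]// _; last by rewrite leey.
by have := key _ _ hu; rewrite hxi !lee_fin; lra.
Unshelve. all: end_near. Qed.

Lemma frechet_subdiffP h w v (r : R) : h w = r%:E ->
  (forall e : R, 0 < e -> exists2 del : R, 0 < del & forall u,
     enorm (u - w) < del -> ((r + dot v (u - w) - e * enorm (u - w))%:E <= h u)%E) ->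
  frechet_subdiff h w v.
Proof.
move=> hw hu; split; first by rewrite hw.
rewrite limf_einfE; apply/lee_addgt0Pr => e e0; have [del del0 hdel] := hu e e0.
rewrite -leeBlDr// sub0e; pose V := [set u | u <> w /\ enorm (u - w) < del].
apply: (@le_trans _ _ (ereal_inf ((fun u : 'cV[R]_d =>
    (h u - h w - (dot v (u - w))%:E) * ((enorm (u - w))^-1)%:E)%E @` V))); last first.
  apply: ereal_sup_ubound; exists V => //.
  have : nbhs w [set u | enorm (u - w) < del] by apply/nbhs_enormP; exists del.
  by apply: filterS => u /= uw; split=> //; exact/eqP.
apply: le_ereal_inf_tmp => _ [u [uw ud] <-]; have := hdel u ud; rewrite hw.
have n0 : 0 < enorm (u - w) by apply: enorm_gt0 => /subr0_eq.
case: (h u) => [t| |]//; last first.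
  by rewrite gt0_mulye ?leey// lte_fin invr_gt0.
rewrite -!EFinB -EFinM -EFinN !lee_fin => h1.
by rewrite ler_pdivlMr//; lra.
Qed.

Lemma frechet_lim_subdiff h w : frechet_subdiff h w `<=` lim_subdiff h w.
Proof.
move=> v hv; split; first by case: hv.
by exists (fun=> w), (fun=> v); split=> //; exact: cvg_cst.
Qed.

Lemma subgradient_frechet h w v : subgradient h w v -> frechet_subdiff h w v.
Proof.
move=> [r hw hu]; apply: (frechet_subdiffP hw) => e e0; exists 1 => // u _.
apply: le_trans (hu u); rewrite lee_fin gerBl.
by rewrite mulr_ge0 ?enorm_ge0// ltW.
Qed.

(** The points where [z] is a subgradient form a convex subset of [dom_subdiff h] on which [h] is
    affine; strict convexity would fail at the midpoint of two of them. *)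
Lemma esc_subgradient_inj h z xi xi' : econvex h -> essentially_strictly_convex h ->
  subgradient h xi z -> subgradient h xi' z -> xi = xi'.
Proof.
move=> hconv hesc sxi sxi'; apply: contrapT => neq.
pose C := [set w | subgradient h w z].
have Csub : C `<=` dom_subdiff h.
  by move=> w Cw; exists z; exact/frechet_lim_subdiff/subgradient_frechet.
have Cconv : convex_set C.
  move=> w1 w2 l; rewrite !inE => -[r1 h1 H1] [r2 h2 H2].
  have l01 : 0 <= l%:num <= 1 by rewrite ge0 le1.
  have E12 : r1 + dot z (w2 - w1) <= r2 by rewrite -lee_fin -h2.
  have E21 : r2 + dot z (w1 - w2) <= r1 by rewrite -lee_fin -h1.
  have E : r2 = r1 + dot z (w2 - w1) by move: E12 E21; rewrite !dotE; lra.
  have H3 := hconv w1 w2 _ l01; have H4 := H1 (l%:num *: w1 + (1 - l%:num) *: w2).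
  rewrite h1 h2 -!EFinM -EFinD in H3.
  set w3 := _ + _ in H3 H4 *.
  have w3E : w3 - w1 = (1 - l%:num) *: (w2 - w1).
    by apply/matrixP => i j; rewrite /w3 !mxE; ring.
  exists (r1 + (1 - l%:num) * dot z (w2 - w1)).
    apply/eqP; rewrite eq_le; apply/andP; split.
      by apply: le_trans H3 _; rewrite lee_fin E; lra.
    by apply: le_trans H4; rewrite w3E dotZr.
  move=> u; apply: le_trans (H1 u).
  have -> : u - w1 = (u - w3) + (w3 - w1) by rewrite addrA subrK.
  by rewrite [dot z (u - w3 + _)]dotDr w3E dotZr lee_fin; lra.
have C0 : C !=set0 by exists xi.
have := hesc C C0 Cconv Csub xi xi' 2^-1 sxi sxi' neq.
have [r h1 H1] := sxi; have [r' h2 H2] := sxi'.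
rewrite h1 h2 -!EFinM -EFinD.
have -> : 0 < (2^-1 : R) < 1 by lra.
move=> /(_ isT); have := H1 (2^-1 *: xi + (1 - 2^-1) *: xi').
have := H2 xi; rewrite h1 lee_fin.
set w3 := _ *: _ + _ => k1 /le_lt_trans/[apply]; rewrite lte_fin.
have -> : w3 - xi = 2^-1 *: (xi' - xi).
  by apply/matrixP => i j; rewrite /w3 !mxE; field.
by move: k1; rewrite !dotE; lra.
Qed.

(* The margin of [h] over its supporting affine function on a small sphere
   around [xi] grows linearly outside, so tilting [z] slightly keeps the
   supremum defining the conjugate inside the ball. *)
Lemma conjugate_upper_expansion h z xi (c : R) : eproper h -> econvex h ->
  lower_semicontinuous h -> essentially_strictly_convex h ->
  subgradient h xi z -> conjugate h z = c%:E ->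
  forall e : R, 0 < e -> exists2 del : R, 0 < del & forall z',
    enorm (z' - z) < del ->
    (conjugate h z' <= (c + dot xi (z' - z) + e * enorm (z' - z))%:E)%E.
Proof.
move=> [hNy hdom] hconv hlsc hesc sxi hc e e0.
have [r hxi hu] := sxi; have := conjugate_subgradient hxi sxi; rewrite hc => -[cE].
(* The inequality is strict on the sphere: at a point of equality [z] would be a subgradient too,
   against [esc_subgradient_inj]. *)
have [del0 del0_gt0 hmargin] : exists2 del0 : R, 0 < del0 & forall w,
    enorm (w - xi) = e -> ((r + dot z (w - xi) + del0)%:E <= h w)%E.
  apply: (lsc_compact_margin hlsc _ (@compact_enorm_sphere R d xi e)).
    have -> : (fun w => r + dot z (w - xi)) = (fun w => r + (dot z w - dot z xi)).
      by apply/funext => w; rewrite dotDr dotNr.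
    move=> w; have zw := @continuous_dotr _ _ z w.
    exact: (cvgD (cvg_cst _) (cvgB zw (cvg_cst _))).
  move=> w /= we; rewrite lt_neqAle hu andbT; apply/eqP => hw.
  have sw : subgradient h w z.
    exists (r + dot z (w - xi)) => // u; apply: le_trans (hu u).
    by rewrite lee_fin !dotE; lra.
  move: we; rewrite (esc_subgradient_inj hconv hesc sxi sw) subrr enorm0.
  by move=> e00; rewrite -e00 ltxx in e0.
(* The sphere has the tolerance [e] as its radius. Inside, tilting by [n] costs at most [e * n];
   outside, the margin at distance [m] is at least [del0 / e * m], more than the cost [n * m]. *)
exists (del0 / e); first exact: divr_gt0.
move=> z'; rewrite ltr_pdivlMr// => zd; apply: conjugate_le => u.
have n0 := enorm_ge0 (z' - z); set n := enorm (z' - z) in zd n0 *.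
have m0 := enorm_ge0 (u - xi).
have CS : dot (z' - z) (u - xi) <= n * enorm (u - xi) by exact: CauchySchwarz_dot.
set m := enorm (u - xi) in CS m0 *.
have [me|me] := leP m e.
  apply: le_trans (hu u); rewrite lee_fin cE.
  move: CS; rewrite !dotE (dotC xi z') (dotC xi z) => CS; nra.
case hU : (h u) (hNy u) => [t| |]// _; last by rewrite leey.
pose l := e / m.
have mm : 0 < m by lra.
have lm : l * m = e by rewrite /l divfK// gt_eqF.
have l01 : 0 <= l <= 1.
  by rewrite /l divr_ge0 ?ler_pdivrMr//; lra.
have wE : l *: u + (1 - l) *: xi - xi = l *: (u - xi).
  by apply/matrixP => i j; rewrite !mxE; ring.
have := hmargin (l *: u + (1 - l) *: xi); rewrite wE enormZ ger0_norm; last by lra.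
rewrite -/m lm => /(_ erefl) hm.
have := le_trans hm (hconv u xi l l01); rewrite hU hxi -!EFinM -EFinD !lee_fin dotZr => ht.
have l0 : 0 < l by rewrite divr_gt0.
have ht2 : dot z (u - xi) + n * m <= t - r.
  rewrite -(ler_pM2l l0); nra.
by move: ht2 CS; rewrite cE !dotE (dotC xi z') (dotC xi z) => ht2 CS; nra.
Qed.

End Conjugate.

(** * Quadratic bounds for functions with Lipschitz gradient *)

Section Gradient.
Context {R : realType} {d : nat}.
Implicit Types (h : 'cV[R]_d -> R) (x v : 'cV[R]_d).

Lemma gradient_dot h x v : differentiable h x -> 'D_v h x = dot (gradient h x) v.
Proof.
move=> hx; rewrite deriveE// {1}(_ : v = \sum_i v i 0 *: delta_mx i 0); last first.
  by rewrite {1}[v]matrix_sum_delta; apply: eq_bigr => i _; rewrite big_ord1.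
rewrite linear_sum; apply: eq_bigr => i _.
by rewrite linearZ /= mxE deriveE// mulrC.
Qed.

Lemma is_derive_line h x v (t : R) : differentiable h (x + t *: v) ->
  is_derive t 1 (fun s : R => h (x + s *: v)) (dot (gradient h (x + t *: v)) v).
Proof.
move=> hx; rewrite -gradient_dot//.
have hd : derivable h (x + t *: v) v by exact: diff_derivable.
have E : (fun k : R => k^-1 *: (((fun s : R => h (x + s *: v)) \o shift t) (k *: 1) -
    h (x + t *: v))) = (fun k => k^-1 *: ((h \o shift (x + t *: v)) (k *: v) - h (x + t *: v))).
  apply/funext => k /=; congr (_ *: (h _ - _)).
  by rewrite addrCA -scalerDl; congr (_ + _ *: _); rewrite /GRing.scale/= mulr1.
by split; rewrite /derivable /derive E.
Qed.

(** The mean value theorem is applied to [h] on the segment minus its quadratic model; by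
    Cauchy-Schwarz and the Lipschitz bound the derivative of this difference is nonpositive. *)
Lemma lipschitz_gradient_upper h (L : R) : (forall x, differentiable h x) ->
  (forall x1 x2, enorm (gradient h x1 - gradient h x2) <= L * enorm (x1 - x2)) ->
  forall x v, h (x + v) <= h x + dot (gradient h x) v + L / 2 * enorm v ^+ 2.
Proof.
move=> hd hL x v; pose gx := dot (gradient h x) v; pose q := L / 2 * enorm v ^+ 2.
pose psi (t : R) := h (x + t *: v) - (t * gx + q * t ^+ 2).
have psiD (t : R) : is_derive t 1 psi
    (dot (gradient h (x + t *: v)) v - (gx + q * (2 * t))).
  have ? := is_derive_line (hd (x + t *: v)).
  apply: is_deriveB; apply: is_derive_eq.
  by rewrite /GRing.scale/=; ring.
have [|c] := @MVT _ psi _ 0 1 ltr01 (fun t _ => psiD t).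
  apply: continuous_subspaceT => t; apply: differentiable_continuous.
  by apply/derivable1_diffP; apply: ex_derive.
rewrite in_itv/= => /andP[c0 c1].
rewrite /psi scale1r scale0r addr0 subr0 mulr1 => E.
suff : dot (gradient h (x + c *: v)) v - (gx + q * (2 * c)) <= 0.
  by move: E; rewrite /gx /q; lra.
have := CauchySchwarz_dot (gradient h (x + c *: v) - gradient h x) v.
have := hL (x + c *: v) x; rewrite addrAC subrr add0r enormZ gtr0_norm//.
move=> /(ler_wpM2r (enorm_ge0 v)).
by rewrite dotDl dotNl -/gx /q; lra.
Qed.

(** The upper bound is used from [x + v] back to [x]; moving the gradient to [x] costs another
    [L * enorm v ^+ 2], hence the factor 3. Any error quadratic in [v] is good enough for a Frechet
    subgradient. *)
Lemma lipschitz_gradient_lower h (L : R) : (forall x, differentiable h x) ->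
  (forall x1 x2, enorm (gradient h x1 - gradient h x2) <= L * enorm (x1 - x2)) ->
  forall x v, h x + dot (gradient h x) v - 3 * L / 2 * enorm v ^+ 2 <= h (x + v).
Proof.
move=> hd hL x v; have := lipschitz_gradient_upper hd hL (x + v) (- v).
rewrite addrK enormN dotNr.
have := CauchySchwarz_dot (gradient h (x + v) - gradient h x) (- v).
have := hL (x + v) x; rewrite addrAC subrr add0r.
move=> /(ler_wpM2r (enorm_ge0 v)).
by rewrite enormN dotNr dotDl dotNl; lra.
Qed.

End Gradient.

(** * The merit function in real terms, and its Frechet subgradients *)

Section Merit.
Context {R : realType} {n p s : nat}.
Local Notation W := 'cV[R]_(n + (p + (s + s))).

Definition merit_point (x : 'cV[R]_n) (y : 'cV[R]_p) (z u : 'cV[R]_s) : W :=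
  col_mx x (col_mx y (col_mx z u)).

Lemma merit_pointE x y z u :
  (blk_x (merit_point x y z u) = x) * (blk_y (merit_point x y z u) = y) *
  (blk_z (merit_point x y z u) = z) * (blk_u (merit_point x y z u) = u).
Proof. by rewrite /blk_x /blk_y /blk_z /blk_u !(col_mxKu, col_mxKd). Qed.

Lemma merit_pointB x y z u x' y' z' u' :
  merit_point x y z u - merit_point x' y' z' u' =
  merit_point (x - x') (y - y') (z - z') (u - u').
Proof. by rewrite /merit_point !opp_col_mx !add_col_mx. Qed.

Lemma blkK (w : W) : merit_point (blk_x w) (blk_y w) (blk_z w) (blk_u w) = w.
Proof. by rewrite /merit_point !vsubmxK. Qed.

Lemma dot_col_mx d1 d2 (a c : 'cV[R]_d1) (b e : 'cV[R]_d2) :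
  dot (col_mx a b) (col_mx c e) = dot a c + dot b e.
Proof.
rewrite /dot big_split_ord/=; congr (_ + _); apply: eq_bigr => i _.
  by rewrite !col_mxEu.
by rewrite !col_mxEd.
Qed.

Lemma dot_merit_point x y z u x' y' z' u' :
  dot (merit_point x y z u) (merit_point x' y' z' u') =
  dot x x' + dot y y' + dot z z' + dot u u'.
Proof. by rewrite !dot_col_mx !addrA. Qed.

Lemma enorm_merit_point x y z u : enorm (merit_point x y z u) ^+ 2 =
  enorm x ^+ 2 + enorm y ^+ 2 + enorm z ^+ 2 + enorm u ^+ 2.
Proof. by rewrite !sqr_enorm dot_merit_point. Qed.

Lemma enorm_merit_point_le x y z u :
  enorm (merit_point x y z u) <= enorm x + enorm y + enorm z + enorm u.
Proof.
have [x0 y0 z0 u0] := And4 (enorm_ge0 x) (enorm_ge0 y) (enorm_ge0 z) (enorm_ge0 u).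
rewrite -(ler_pXn2r (n := 2)) ?nnegrE ?enorm_ge0 ?addr_ge0//.
by rewrite enorm_merit_point; nra.
Qed.

Lemma cvg_merit_point (x_ : nat -> 'cV[R]_n) (y_ : nat -> 'cV[R]_p)
    (z_ u_ : nat -> 'cV[R]_s) x y z u : x_ @ \oo --> x -> y_ @ \oo --> y ->
  z_ @ \oo --> z -> u_ @ \oo --> u ->
  (fun k => merit_point (x_ k) (y_ k) (z_ k) (u_ k)) @ \oo --> merit_point x y z u.
Proof.
move=> /cvg_enormP hx /cvg_enormP hy /cvg_enormP hz /cvg_enormP hu; apply/cvg_enormP.
apply: (@squeeze_cvgr _ _ _ _ (fun=> 0) (fun k => enorm (x_ k - x) + enorm (y_ k - y)
  + enorm (z_ k - z) + enorm (u_ k - u))).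
- by near=> k; rewrite enorm_ge0/= merit_pointB enorm_merit_point_le.
- exact: cvg_cst.
- by rewrite -[X in _ --> X](addr0 0) -{1}(addr0 0) -{1}(addr0 0); do 3 apply: cvgD => //.
Unshelve. all: end_near. Qed.

Variables (S : set 'cV[R]_n) (f : 'cV[R]_p -> \bar R) (g : 'cV[R]_s -> \bar R).
Variables (A : 'M[R]_(s, n)) (K : 'M[R]_(p, n)) (vphi : 'cV[R]_n -> R).
Variables (al alt : R).

(** [G] and [F] stand for the finite values of [conjugate g z] and [conjugate f y], so that the
    estimates are between reals. *)
Definition merit_real (x : 'cV[R]_n) (y : 'cV[R]_p) (z u : 'cV[R]_s) (G F : R) : R :=
  dot z (A *m x) - G + vphi x - dot (K *m x) y + F
  + al / 2 * (1 + 4 * al / (alt - al)) * enorm (z - u) ^+ 2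
  - 2^-1 * (alt - al) * enorm z ^+ 2.

Lemma meritE x y z u (G F : R) : S x -> conjugate g z = G%:E ->
  conjugate f y = F%:E ->
  merit S f g A K vphi al alt x y z u = (merit_real x y z u G F)%:E.
Proof.
move=> Sx hG hF; rewrite /merit hG hF /indicator asboolT// adde0.
by rewrite -!(EFinB, EFinD).
Qed.

Lemma merit_notin x y z u (G : R) : (-oo < conjugate f y)%E -> conjugate g z = G%:E ->
  ~ (S x /\ exists F : R, conjugate f y = F%:E) ->
  merit S f g A K vphi al alt x y z u = +oo%E.
Proof.
move=> fy hG hn; rewrite /merit hG /indicator.
have [Sx|Sx] := pselect (S x).
  rewrite asboolT//; case: (conjugate f y) fy hn => [F _ []|_ _|]//.
  by split=> //; exists F.
by rewrite asboolF//; case: (conjugate f y) fy.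
Qed.

Variable (L : R).
Hypotheses (f_proper : eproper f) (g_proper : eproper g) (g_convex : econvex g).
Hypotheses (g_lsc : lower_semicontinuous g) (g_esc : essentially_strictly_convex g).
Hypotheses (vphi_diff : forall x : 'cV[R]_n, differentiable vphi x).
Hypotheses (vphi_lip : forall x1 x2 : 'cV[R]_n,
  enorm (gradient vphi x1 - gradient vphi x2) <= L * enorm (x1 - x2)).
Hypotheses (al_ge0 : 0 <= al) (al_lt : al < alt).

Let c := al * (1 + 4 * al / (alt - al)).

(** The formal sum rule, block by block: [nx] is meant in the normal cone of [S], [eta] and [xi] as
    subgradients of the conjugates at [y] and [z]. The factor [c] is twice the coefficient of
    [enorm (z - u) ^+ 2] in the merit function. *)
Definition merit_subgrad (x : 'cV[R]_n) (y : 'cV[R]_p) (z u : 'cV[R]_s)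
    (nx : 'cV[R]_n) (eta : 'cV[R]_p) (xi : 'cV[R]_s) : W :=
  merit_point (A^T *m z + gradient vphi x - K^T *m y + nx) (eta - K *m x)
    (A *m x - xi + c *: (z - u) - (alt - al) *: z) (- (c *: (z - u))).

(* [- conjugate g] is concave, so only its differentiability at [z], granted by
   essential strict convexity of [g], yields a Frechet subgradient. *)
Lemma merit_frechet x y z u nx eta xi : S x ->
  (forall x', S x' -> dot nx (x' - x) <= 0) ->
  subgradient f eta y -> subgradient g xi z ->
  frechet_subdiff (merit_vec S f g A K vphi al alt) (merit_point x y z u)
    (merit_subgrad x y z u nx eta xi).
Proof.
move=> Sx hnx sf sg.
have [F hF hFu] := subgradient_conjugate sf.
have [G hG hGu] := subgradient_conjugate sg.
have [CA CA0 hCA] := enorm_mulmx_bounded A.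
have [CK CK0 hCK] := enorm_mulmx_bounded K.
have L0 : 0 <= `|L| by [].
have ta : 0 < alt - al by rewrite subr_gt0.
have al0 := al_ge0.
have c0 : 0 <= c.
  by apply: mulr_ge0 => //; apply: addr_ge0 => //; apply: divr_ge0; lra.
(* [Q] gathers the second-order errors: the bilinear terms in [A] and [K], the lower bound for
   [vphi], and the concave term in [enorm z ^+ 2]. Near the point they use half of [e]; the other
   half pays for the expansion of [conjugate g]. *)
pose Q := CA + CK + 3 * `|L| / 2 + (alt - al) / 2.
have Q0 : 0 <= Q by rewrite /Q; nra.
have hw : merit_vec S f g A K vphi al alt (merit_point x y z u) =
    (merit_real x y z u G F)%:E by rewrite /merit_vec !merit_pointE; exact: meritE.
apply: (frechet_subdiffP hw) => e e0.
have e20 : 0 < e / 2 by lra.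
have [del1 del10 hdel1] :=
  conjugate_upper_expansion g_proper g_convex g_lsc g_esc sg hG e20.
have Q1 : 0 < 2 * (Q + 1) by nra.
exists (Num.min del1 (e / (2 * (Q + 1)))).
  by rewrite lt_min del10 divr_gt0.
move=> w'; rewrite -[w']blkK; move: (blk_x w') (blk_y w') (blk_z w') (blk_u w').
move=> {w'} x' y' z' u'; rewrite merit_pointB lt_min => /andP[].
set N := enorm _; rewrite ltr_pdivlMr// => Nd Ne.
rewrite /merit_vec !merit_pointE.
have N0 : 0 <= N by exact: enorm_ge0.
have N2 := enorm_merit_point (x' - x) (y' - y) (z' - z) (u' - u); rewrite -/N in N2.
have [a0 b0 d0 o0] := And4 (enorm_ge0 (x' - x)) (enorm_ge0 (y' - y))
  (enorm_ge0 (z' - z)) (enorm_ge0 (u' - u)).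
have aN : enorm (x' - x) <= N by nra.
have bN : enorm (y' - y) <= N by nra.
have dN : enorm (z' - z) <= N by nra.
have gz' := hdel1 z' (le_lt_trans dN Nd).
have [G' hG'] : exists G' : R, conjugate g z' = G'%:E.
  by move: gz' (conjugate_gtNy z' g_proper); case: (conjugate g z') => // G'; exists G'.
move: gz'; rewrite hG' lee_fin => gz'.
have fy' := conjugate_gtNy y' f_proper.
have [[Sx' [F' hF']]|hn] := pselect (S x' /\ exists F' : R, conjugate f y' = F'%:E);
  last by rewrite (merit_notin _ fy' hG' hn) leey.
rewrite (meritE _ Sx' hG' hF') lee_fin.
have := hFu y'; rewrite hF' lee_fin => {}fy'.
have hx' := hnx _ Sx'.
have := lipschitz_gradient_lower vphi_diff vphi_lip x (x' - x).
rewrite (addrCA x) subrr addr0 => hphi.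
have := CauchySchwarz_dot (- (z' - z)) (A *m (x' - x)); rewrite enormN => hA.
have := CauchySchwarz_dot (K *m (x' - x)) (y' - y) => hK.
have hA' := le_trans hA (ler_wpM2l d0 (hCA _)).
have hK' := le_trans hK (ler_wpM2r b0 (hCK _)).
(* The coupling term is convex, so it lies above its linearisation and adds no error to [Q]. *)
have hzu : enorm (z - u) ^+ 2 + 2 * dot (z - u) ((z' - z) - (u' - u)) <= enorm (z' - u') ^+ 2.
  have -> : z' - u' = (z - u) + ((z' - z) - (u' - u)).
    by apply/matrixP => i j; rewrite !mxE; ring.
  rewrite !sqr_enorm; have := dotxx_ge0 ((z' - z) - (u' - u)).
  move: (z - u) ((z' - z) - (u' - u)) => P1 P2; rewrite !dotE (dotC P2 P1); lra.
have hz : enorm z' ^+ 2 = enorm z ^+ 2 + 2 * dot z (z' - z) + enorm (z' - z) ^+ 2.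
  by rewrite !sqr_enorm !dotE (dotC z' z); ring.
have hQ : enorm (z' - z) * (CA * enorm (x' - x)) + CK * enorm (x' - x) * enorm (y' - y)
    + 3 * L / 2 * enorm (x' - x) ^+ 2 + (alt - al) / 2 * enorm (z' - z) ^+ 2
    <= Q * N ^+ 2.
  have prodN (r1 r2 : R) : 0 <= r1 <= N -> 0 <= r2 <= N -> r1 * r2 <= N ^+ 2.
    by move=> /andP[? ?] /andP[? ?]; rewrite expr2 ler_pM.
  have -> : Q * N ^+ 2 = CA * N ^+ 2 + CK * N ^+ 2 + 3 * `|L| / 2 * N ^+ 2
      + (alt - al) / 2 * N ^+ 2 by rewrite /Q; ring.
  apply: lerD; first apply: lerD; first apply: lerD.
  - by rewrite mulrCA ler_wpM2l// prodN ?d0 ?a0.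
  - by rewrite -mulrA ler_wpM2l// prodN ?a0 ?b0.
  - apply: (@le_trans _ _ (3 * `|L| / 2 * enorm (x' - x) ^+ 2)).
      by apply: ler_wpM2r; [exact: sqr_ge0|have := ler_norm L; lra].
    by rewrite ler_wpM2l ?expr2 ?prodN ?a0//; lra.
  - by rewrite ler_wpM2l ?expr2 ?prodN ?d0//; lra.
have QN : Q * N <= e / 2 by lra.
have /(le_trans hQ) {}hQ : Q * N ^+ 2 <= e / 2 * N by rewrite expr2 mulrA; exact: ler_wpM2r.
have hed : e / 2 * enorm (z' - z) <= e / 2 * N by rewrite ler_wpM2l//; lra.
have c20 : 0 <= c / 2 by lra.
have hzu' := ler_wpM2l c20 hzu.
have hzu'' : c / 2 * enorm (z - u) ^+ 2 + dot (c *: (z - u)) ((z' - z) - (u' - u))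
    <= c / 2 * enorm (z' - u') ^+ 2 by move: hzu'; rewrite dotZl; lra.
rewrite /merit_subgrad dot_merit_point /merit_real hz.
have -> : al / 2 * (1 + 4 * al / (alt - al)) = c / 2 by rewrite /c mulrAC.
move: hzu'' fy' gz' hx' hphi hA' hK' hQ hed.
move: (c *: (z - u)) (enorm (z' - z)) (enorm (z - u)) (enorm (z' - u'))
  (enorm (x' - x)) (enorm (y' - y)) => zu nd nzu nzu' na nb.
have dotT m1 m2 (M : 'M[R]_(m1, m2)) q1 q2 : dot (M^T *m q1) q2 = dot q1 (M *m q2).
  by rewrite dotC -dot_mulmxl dotC.
rewrite !(dotE, dotT, mulmxBr, mulmxDr, mulmxN).
rewrite (dotC (K *m x) y) (dotC (K *m x) y') (dotC (K *m x') y) (dotC (K *m x') y').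
rewrite (dotC (A *m x) z) (dotC (A *m x) z').
lra.
Qed.
End Merit.

(** * Decay of a scalar sequence under descent and a KL inequality *)

Section Rates.
Context {R : realType}.

(** Concavity of the power, obtained from Young's inequality for 1 and the [w]-th power of [b / a],
    with exponents [w^-1] and [(1 - w)^-1]. *)
Lemma powR_tangent (a b w : R) : 0 < a -> 0 <= b -> 0 < w < 1 ->
  w * a `^ (w - 1) * (a - b) <= a `^ w - b `^ w.
Proof.
move=> a0 b0 /andP[w0 w1]; pose t := b / a.
have t0 : 0 <= t by rewrite divr_ge0// ltW.
have tw : t `^ w <= t * w + (1 - w).
  have := @conjugate_powR R (t `^ w) 1 w^-1 (1 - w)^-1.
  rewrite mulr1 -powRrM mulfV ?gt_eqF// powRr1// powR1 !invrK mul1r; apply => //.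
  - exact: powR_ge0.
  - by rewrite invr_gt0.
  - by rewrite invr_gt0 subr_gt0.
  - by rewrite addrC subrK.
have bE : b = a * t by rewrite /t mulrCA mulfV ?mulr1// gt_eqF.
have aw : a `^ w = a * a `^ (w - 1) by rewrite mulr_powRB1// ltW.
rewrite {1}bE (_ : b `^ w = a `^ w * t `^ w); last by rewrite bE powRM// ltW.
have := ler_wpM2l (powR_ge0 a w) tw; rewrite aw; lra.
Qed.

Lemma powR_le2r (w a b : R) : 0 <= w -> 0 <= a -> a <= b -> a `^ w <= b `^ w.
Proof.
move=> w0 a0 ab; apply: ge0_ler_powR => //; rewrite nnegrE//.
exact: le_trans ab.
Qed.

Lemma double_ltn_bounds (M k : nat) :
  (M + M < k)%N -> (M <= k)%N /\ (k.+1 <= (k - M) * 2)%N.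
Proof. lia. Qed.

Section KL_recursion.
Variables (E D : nat -> R) (N : nat) (theta C c1 : R).
Hypotheses (C_gt0 : 0 < C) (c1_gt0 : 0 < c1).
Hypotheses (E_ge0 : forall k, (N <= k)%N -> 0 <= E k) (D_ge0 : forall k, 0 <= D k).
Hypothesis E_decr : forall k, (N <= k)%N -> E k.+1 + c1 * D k.+1 ^+ 2 <= E k.
Hypothesis E_KL : forall k, (N <= k)%N -> 0 < E k -> E k `^ theta <= C * D k.
Hypothesis E_cvg0 : E @ \oo --> (0 : R).

Lemma KL_eventually_lt (e : R) : 0 < e ->
  exists2 M, (N <= M)%N & forall k, (M <= k)%N -> E k < e.
Proof.
move=> e0; have := (cvgr0Pnorm_lt _).1 E_cvg0 e e0.
move=> [M _ hM]; exists (maxn N M) => [|k]; first by rewrite leq_maxl.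
rewrite geq_max => /andP[_ Mk].
by apply: le_lt_trans (hM k Mk); exact: ler_norm.
Qed.

(** The step length is eliminated: the squared KL inequality bounds the left-hand side by
    [C ^+ 2 * D k.+1 ^+ 2], and the descent bounds [D k.+1 ^+ 2]. *)
Lemma KL_step k : (N <= k)%N -> 0 < E k.+1 ->
  E k.+1 `^ (2 * theta) <= C ^+ 2 / c1 * (E k - E k.+1).
Proof.
move=> Nk Ek; have := E_KL (leqW Nk) Ek; have := E_decr Nk.
rewrite [2 * theta]mulrC powRrM powR_mulrn ?powR_ge0//.
have := powR_ge0 (E k.+1) theta; have := D_ge0 k.+1.
move: (E _ `^ _) (D _) => X Y Y0 X0 h1 h2.
have h3 : X ^+ 2 <= C ^+ 2 * Y ^+ 2 by rewrite -exprMn !expr2 ler_pM.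
apply: le_trans h3 _; rewrite -mulrA ler_wpM2l ?sqr_ge0//.
by rewrite mulrC ler_pdivlMr//; lra.
Qed.

Lemma KL_decr k : (N <= k)%N -> E k.+1 <= E k.
Proof.
by move=> Nk; apply: le_trans (E_decr Nk); rewrite lerDl mulr_ge0 ?sqr_ge0// ltW.
Qed.

Lemma KL_D_le k : (N <= k)%N -> D k.+1 <= Num.sqrt (E k / c1).
Proof.
move=> Nk; rewrite -(@ler_pXn2r _ 2)// ?nnegrE ?sqrtr_ge0//.
rewrite sqr_sqrtr; last by rewrite divr_ge0 ?E_ge0// ltW.
have := E_decr Nk; have := E_ge0 (leqW Nk); rewrite ler_pdivlMr//; lra.
Qed.

Lemma KL_E0_D0 k : (N <= k)%N -> E k = 0 -> D k.+1 = 0.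
Proof.
move=> Nk Ek; apply/eqP; rewrite eq_le D_ge0 andbT.
by have := KL_D_le Nk; rewrite Ek mul0r sqrtr0.
Qed.

(** With exponent 0, a positive [E k.+1] forces a decrease of at least [c1 / C ^+ 2], impossible
    once [E k] is below that. So the gap vanishes, and with it the next step. *)
Lemma KL_finite : theta = 0 ->
  exists2 M, (N <= M)%N & forall k, (M <= k)%N -> D k.+1 = 0.
Proof.
move=> th0; have e0 : 0 < c1 / C ^+ 2 by rewrite divr_gt0// exprn_gt0.
have [M NM hM] := KL_eventually_lt e0; exists M.+1; first exact: leqW.
case=> // k; rewrite ltnS => Mk; have Nk := leq_trans NM Mk.
apply: KL_E0_D0; first exact: leqW.
apply/eqP; rewrite eq_le (E_ge0 (leqW Nk)) andbT leNgt; apply/negP => Ek.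
have := KL_step Nk Ek; rewrite th0 mulr0 powRr0.
have := hM _ Mk; rewrite ltr_pdivlMr ?exprn_gt0// => h1.
rewrite mulrAC ler_pdivlMr// => h2.
have : 0 < C ^+ 2 by rewrite exprn_gt0.
by nra.
Qed.

(** Once the gaps are below 1, [2 * theta <= 1] makes [E k.+1] at most the power in [KL_step],
    whence a contraction by [Q]. Steps are bounded by square roots of gaps, so [q] is the root of
    [Q]; the bound is a difference so that its sums telescope. *)
Lemma KL_linear : 0 < theta <= 2^-1 -> exists M (q kappa : R),
  [/\ (N <= M)%N, 0 < q < 1, 0 < kappa &
      forall k, (M <= k)%N -> D k.+1 <= kappa * q ^+ k - kappa * q ^+ k.+1].
Proof.
move=> /andP[th0 th1]; have [M NM hM] := KL_eventually_lt ltr01.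
have C40 : 0 < C ^+ 2 / c1 by rewrite divr_gt0// exprn_gt0.
have := KL_step; move: (C ^+ 2 / c1) C40 => C4 C40 step.
pose Q := C4 / (1 + C4).
have Q0 : 0 < Q by rewrite divr_gt0//; lra.
have Q1 : Q < 1 by rewrite ltr_pdivrMr; lra.
have EQ k : (M <= k)%N -> E k.+1 <= Q * E k.
  move=> Mk; have Nk := leq_trans NM Mk.
  have := E_ge0 (leqW Nk); rewrite le_eqVlt => /predU1P[<-|Ek].
    by rewrite mulr_ge0 ?E_ge0// ltW.
  have E1 : 0 < E k.+1 <= 1 by rewrite Ek/= ltW// hM// leqW.
  have : E k.+1 <= E k.+1 `^ (2 * theta) by apply: ger1_powR => //; lra.
  move=> /le_trans /(_ (step _ Nk Ek)); rewrite /Q mulrAC ler_pdivlMr; lra.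
have EM j : E (M + j)%N <= Q ^+ j.
  elim: j => [|j IH]; first by rewrite addn0 expr0 ltW// hM.
  rewrite addnS exprS; apply: le_trans (EQ _ (leq_addr _ _)) _.
  by rewrite ler_wpM2l// ltW.
pose q := Num.sqrt Q.
have q0 : 0 < q by rewrite sqrtr_gt0.
have q1 : q < 1 by rewrite -sqrtr1 ltr_sqrt.
have k0 : 0 < Num.sqrt c1^-1 / q ^+ M / (1 - q).
  by rewrite !divr_gt0 ?sqrtr_gt0 ?invr_gt0 ?exprn_gt0//; lra.
(* Division by [q ^+ M] accounts for a contraction that starts only at [M]; division by [1 - q]
   turns a power of [q] into a difference of consecutive terms. *)
exists M, q, (Num.sqrt c1^-1 / q ^+ M / (1 - q)); split=> //; first by rewrite q0.
move=> k Mk; have Nk := leq_trans NM Mk; apply: le_trans (KL_D_le Nk) _.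
rewrite -mulrBr exprS -[X in _ * (X - _)]mul1r -mulrBl mulrA divfK; last first.
  by rewrite gt_eqF//; lra.
rewrite -(subnKC Mk) exprD mulrA divfK; last by rewrite gt_eqF// exprn_gt0.
rewrite mulrC sqrtrM ?invr_ge0 ?(ltW c1_gt0)//; apply: ler_wpM2l => //.
apply: le_trans (ler_wsqrtr (EM _)) _.
rewrite -(@ler_pXn2r _ 2)// ?nnegrE ?sqrtr_ge0 ?exprn_ge0 ?(ltW q0)//.
by rewrite sqr_sqrtr ?exprn_ge0 ?(ltW Q0)// exprAC sqr_sqrtr// ltW.
Qed.

Hypothesis theta_itv : 2^-1 < theta < 1.
Let p := 2 * theta - 1.

(** Discrete counterpart of the differential inequality [E' <= - E^(1 + p) / C4], under which
    [E^(- p)] grows at least linearly. *)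
Lemma KL_inverse_power_growth M : (N <= M)%N -> (forall k, (M <= k)%N -> E k <= 1) ->
  forall j, 0 < E (M + j)%N -> p / (C ^+ 2 / c1 + 1) * j%:R <= E (M + j)%N `^ (- p).
Proof.
move=> NM E1; have /andP[th0 th1] := theta_itv.
have p0 : 0 < p by rewrite /p; lra.
have p1 : p < 1 by rewrite /p; lra.
have C40 : 0 < C ^+ 2 / c1 by rewrite divr_gt0// exprn_gt0.
elim=> [|j IH Ej]; first by rewrite mulr0 powR_ge0.
have Mj : (M <= M + j)%N by exact: leq_addr.
have Nj := leq_trans NM Mj.
rewrite addnS in Ej *.
have Ebig := lt_le_trans Ej (KL_decr Nj).
have {IH} := IH Ebig; have := KL_step Nj Ej; move: (C ^+ 2 / c1) C40 => C4 C40.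
have a1 := E1 _ (leqW Mj).
rewrite (_ : 2 * theta = 1 + p); last by rewrite /p; lra.
rewrite powRD; last by rewrite (gt_eqF Ej) implybT.
rewrite powRr1 ?(ltW Ej)//.
move: (E (M + j)%N) (E (M + j).+1) Ej Ebig a1 => b a a0 b0 a1.
have ap0 : 0 < a `^ p by exact: powR_gt0.
have ap1 : a `^ p <= 1.
  by have := powR_le2r (ltW p0) (ltW a0) a1; rewrite powR1.
(* [KL_step] amounts to [b' <= b]. The ratio [b / a] is not bounded above, so the tangent is taken
   at [b']: as [a <= 1], one has [t * C4 <= 1], and this yields the increment [p / (C4 + 1)]. *)
pose t := a `^ p / C4; pose b' := a * (1 + t) => hab hb.
have t0 : 0 < t by rewrite divr_gt0.
have tC4 : t * C4 = a `^ p by rewrite divfK// gt_eqF.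
have b'0 : 0 < b' by rewrite mulr_gt0//; lra.
have b'b : b' <= b.
  rewrite -(ler_pM2l C40) /b' mulrDr mulr1 mulrDr (mulrCA C4) (mulrC C4 t) tC4; lra.
have p01 : 0 < p < 1 by rewrite p0.
have := powR_tangent b'0 (ltW a0) p01.
have bp : b' `^ p = b' * b' `^ (p - 1) by rewrite mulr_powRB1// ltW.
have b'p0 : 0 < b' `^ p by exact: powR_gt0.
have b'pb : b `^ (- p) <= b' `^ (- p).
  rewrite !powRN lef_pV2 ?posrE ?powR_gt0//.
  exact: powR_le2r (ltW p0) (ltW b'0) b'b.
have -> : b' - a = a * t by rewrite /b'; ring.
move=> htan; rewrite -natr1 mulrDr mulr1.
suff : b' `^ (- p) + p / (C4 + 1) <= a `^ (- p) by lra.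
rewrite !powRN.
have e1 : p * b' `^ (p - 1) * (a * t) = p * b' `^ p * (t / (1 + t)).
  by rewrite bp /b'; field; rewrite gt_eqF//; lra.
rewrite e1 in htan.
have e2 : p / (C4 + 1) * a `^ p <= p * (t / (1 + t)).
  rewrite mulrAC -mulrA; apply: ler_wpM2l; first exact: ltW.
  rewrite ler_pdivrMr; last by lra.
  by rewrite mulrAC ler_pdivlMr -?tC4; [nra|lra].
rewrite -(ler_pM2r (mulr_gt0 ap0 b'p0)).
rewrite mulrDl (mulKf (lt0r_neq0 ap0)) (mulrCA (b' `^ p)^-1) mulVf ?gt_eqF// mulr1.
have := ler_wpM2r (ltW b'p0) e2; lra.
Qed.

(** Concavity of the power [1 - theta] and the KL inequality bound the square of a step by the
    previous step times the decrease of [B * E^(1 - theta)]; the arithmetic-geometric mean then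
    gives the telescoping bound. The exponent arises as [(1 - theta) / p], since [E] decays like
    [k^(- 1 / p)]. *)
Lemma KL_sublinear : exists M (P : nat -> R) (kappa : R), [/\ (N <= M)%N, 0 < kappa &
  forall k, (M <= k)%N -> [/\ D k.+1 <= P k - P k.+1, 0 <= P k &
     P k <= kappa * k%:R `^ (- ((1 - theta) / (2 * theta - 1)))]].
Proof.
have /andP[th0 th1] := theta_itv.
have p0 : 0 < p by rewrite /p; lra.
have C40 : 0 < C ^+ 2 / c1 by rewrite divr_gt0// exprn_gt0.
pose w := 1 - theta; have w01 : 0 < w < 1 by rewrite /w; lra.
have w0 : 0 < w by case/andP: w01.
have [M NM hM] := KL_eventually_lt ltr01.
pose dd := p / (C ^+ 2 / c1 + 1); pose del := dd / 2.
have dd0 : 0 < dd by rewrite divr_gt0//; lra.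
have del0 : 0 < del by rewrite divr_gt0.
(* Past [M + M], the count [k - M] is at least half of [k.+1], hence [del] is half of [dd]. The
   right-hand side is at [k.+1] because [P k.+1] will be bounded through [E k]. *)
have Erate k : (M + M < k)%N -> E k `^ w <= (del * k.+1%:R) `^ (- (w / p)).
  move=> /double_ltn_bounds[MleK kM].
  have := E_ge0 (leq_trans NM MleK); rewrite le_eqVlt => /predU1P[<-|Ek].
    by rewrite powR0 ?powR_ge0// gt_eqF.
  have := KL_inverse_power_growth NM (fun k hk => ltW (hM k hk)) (j := (k - M)%N).
  rewrite subnKC// => /(_ Ek) growth.
  have {}kM : k.+1%:R <= (k - M)%:R * 2 :> R by rewrite -natrM ler_nat.
  have dk0 : 0 < del * k.+1%:R by rewrite mulr_gt0.
  have : del * k.+1%:R <= E k `^ (- p).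
    apply: le_trans growth; rewrite -/dd /del.
    by have := ler_wpM2l (ltW dd0) kM; lra.
  move=> /(powR_le2r (ltW (divr_gt0 w0 p0)) (ltW dk0)).
  rewrite -powRrM mulNr mulrCA mulfV ?gt_eqF// mulr1 !powRN => h.
  by rewrite -lef_pV2 ?posrE ?invr_gt0 ?powR_gt0// invrK.
pose B := C / (c1 * w); have cw0 : 0 < c1 * w by exact: mulr_gt0.
have B0 : 0 < B by exact: divr_gt0.
have Vc0 : 0 <= c1^-1 by rewrite invr_ge0 ltW.
exists (M + M).+2, (fun k => D k + B * E k `^ w),
  ((Num.sqrt c1^-1 + B) * del `^ (- (w / p))).
have NMM : (N <= M + M)%N by rewrite (leq_trans NM)// leq_addr.
split; [by rewrite (leq_trans NMM)// -addn2 leq_addr| |].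
  by rewrite mulr_gt0 ?powR_gt0// ltr_wpDl.
case=> // k Mk; have NMk : (N <= k)%N by exact: leq_trans NMM (ltnW Mk).
split => /=.
- have h := KL_decr (leqW NMk); have hE := E_decr (leqW NMk).
  (* A vanished gap is treated apart, as the tangent and the KL inequality require a positive
     one. *)
  have := E_ge0 (leqW NMk); rewrite le_eqVlt => /predU1P[E0|Ek].
    have E1 : E k.+2 = 0.
      by apply/eqP; rewrite eq_le (E_ge0 (leqW (leqW NMk))) andbT E0.
    by rewrite (KL_E0_D0 (leqW NMk) (esym E0)) E1 -E0 add0r addrK D_ge0.
  have htan := powR_tangent Ek (E_ge0 (leqW (leqW NMk))) w01.
  have hKL := E_KL (leqW NMk) Ek.
  have Eth0 : 0 < E k.+1 `^ theta by exact: powR_gt0.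
  have Eth : E k.+1 `^ theta * E k.+1 `^ (w - 1) = 1.
    by rewrite -powRD ?(gt_eqF Ek) ?implybT// /w (_ : _ + _ = 0) ?powRr0//; ring.
  have := D_ge0 k.+1; have := D_ge0 k.+2.
  move: h hE htan hKL Eth0 Eth; move: (E k.+1) (E k.+2) (D k.+1) (D k.+2)
    (E k.+1 `^ theta) (E k.+1 `^ w) (E k.+2 `^ w) (E k.+1 `^ (w - 1)).
  move=> a b d d' e X Y e' ba hE htan hKL e0 ee' d'0 d0.
  have e'0 : 0 < e' by rewrite -(pmulr_rgt0 _ e0) ee'.
  have XY : 0 <= X - Y by apply: le_trans htan; apply: mulr_ge0; [apply: mulr_ge0; exact: ltW|lra].
  have h1 : w * (a - b) <= e * (X - Y).
    have := ler_wpM2l (ltW e0) htan; rewrite mulrA mulrCA ee' mulr1; exact.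
  have h2 : w * (c1 * d' ^+ 2) <= C * d * (X - Y).
    apply: le_trans (ler_wpM2r XY hKL); apply: le_trans h1.
    by rewrite ler_wpM2l ?(ltW w0)//; lra.
  have h3 : d' ^+ 2 <= d * (B * (X - Y)).
    rewrite -(ler_pM2l cw0) /B [leRHS](_ : _ = C * d * (X - Y)).
      by move: h2; lra.
    by field; rewrite !gt_eqF.
  have BX : 0 <= B * (X - Y) by rewrite mulr_ge0// ltW.
  suff : 2 * d' <= d + B * (X - Y) by lra.
  move: (B * (X - Y)) h3 BX => Z h3 Z0.
  rewrite -(@ler_pXn2r _ 2)// ?nnegrE ?addr_ge0 ?mulr_ge0//.
  by have := sqr_ge0 (d - Z); lra.
- by apply: addr_ge0 => //; apply: mulr_ge0; [exact: ltW|exact: powR_ge0].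
- have E1 : E k <= 1.
    by apply/ltW/hM; exact: leq_trans (leq_addr M M) (ltnW (Mk : (M + M < k)%N)).
  have Ek0 := E_ge0 NMk.
  have hE : E k.+1 `^ w <= E k `^ w.
    by apply: powR_le2r; [exact: ltW|exact: E_ge0 (leqW NMk)|exact: KL_decr].
  (* As [E k <= 1] and [w] is below one half, the square root of [E k] is at most its [w]-th power,
     so both parts of [P] decay alike. *)
  have hD : D k.+1 <= Num.sqrt c1^-1 * E k `^ w.
    apply: le_trans (KL_D_le NMk) _; rewrite mulrC sqrtrM//; apply: ler_wpM2l => //.
    move: Ek0; rewrite le_eqVlt => /predU1P[<-|Ek0].
      by rewrite sqrtr0 powR_ge0.
    rewrite -powR12_sqrt ?(ltW Ek0)//; apply: ger_powR; first by rewrite Ek0.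
    by rewrite /w; lra.
  have := Erate k Mk; rewrite powRM ?(ltW del0)// => hk.
  have sB : 0 <= Num.sqrt c1^-1 + B by rewrite addr_ge0// ltW.
  rewrite -[leRHS]mulrA; apply: le_trans (ler_wpM2l sB hk).
  have := ler_wpM2l (ltW B0) hE; lra.
Qed.

End KL_recursion.
End Rates.

(** * One step with frozen parameters, and the KL inequality along the iterates *)

Section Iteration.
Context {R : realType}.

(** Minimality is tested on the segment from [x] to [c], with [t] chosen as in [prox_optimality] so
    that the quadratic remainder stays below [e]. *)
Lemma proj_normal d (S : set 'cV[R]_d) (w x c : 'cV[R]_d) :
  convex_set S -> Defs.proj S w x -> S c -> dot (w - x) (c - x) <= 0.
Proof.
move=> Sconv [Sx xmin] Sc; apply/ler_addgt0Pr => e e0; rewrite add0r.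
set B := dot (c - x) (c - x); have B0 : 0 <= B by exact: dotxx_ge0.
pose t := e / (e + B); have D0 : 0 < e + B by lra.
have t0 : 0 < t by rewrite divr_gt0.
have t1 : t <= 1 by rewrite ler_pdivrMr//; lra.
have tB : t * B <= e by rewrite mulrAC ler_pdivrMr//; nra.
have := Sconv c x (Itv01 (ltW t0) t1); rewrite !inE => /(_ Sc Sx) Sct.
have := xmin (t *: c + (1 - t) *: x) Sct.
rewrite -(@ler_pXn2r _ 2)// ?nnegrE ?enorm_ge0// !sqr_enorm -(opprB w x).
have -> : t *: c + (1 - t) *: x - w = t *: (c - x) - (w - x).
  by apply/matrixP => i j; rewrite !mxE; ring.
move: @B B0 @t D0 t0 t1 tB Sct => /=; move: (c - x) (w - x) => u v.
rewrite !dotE (dotC v u); set B := dot u u; set t := e / _ => B0 D0 t0 t1 tB _ h.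
rewrite -(ler_pM2l t0); nra.
Qed.

(* With [M = 4 al / tau], adding [M] times the monotonicity inequality
   [(tau + al) t^2 <= X + al * Y] makes the coefficients of [q^2] cancel. *)
Lemma descent_scalar (al tau gamma sigma dx t q pA X Y : R) :
  0 < al -> 0 < tau -> tau <= gamma -> al < gamma / 2 ->
  pA ^+ 2 <= sigma * dx ^+ 2 -> X <= pA * t -> 2 * Y <= t ^+ 2 + q ^+ 2 ->
  (tau + al) * t ^+ 2 <= X + al * Y ->
  X + al * Y - tau / 2 * t ^+ 2
    + al / 2 * (1 + 4 * al / tau) * (t ^+ 2 - q ^+ 2)
  <= (3 * sigma * gamma / (2 * tau ^+ 2)) * dx ^+ 2 - tau / 3 * t ^+ 2.
Proof.
move=> al0 tau0 tg ag hp hX hY hmono.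
have g0 : 0 < gamma by lra.
pose i := tau^-1; have i0 : 0 < i by rewrite invr_gt0.
have it : i * tau = 1 by rewrite mulVf// gt_eqF.
have -> : 3 * sigma * gamma / (2 * tau ^+ 2) * dx ^+ 2 =
    3 * gamma / 2 * i ^+ 2 * (sigma * dx ^+ 2).
  by rewrite /i; field; rewrite gt_eqF.
have h1 : 3 * gamma / 2 * i ^+ 2 * pA ^+ 2 <= 3 * gamma / 2 * i ^+ 2 * (sigma * dx ^+ 2).
  apply: ler_wpM2l hp; apply: mulr_ge0; [lra|exact: sqr_ge0].
have m0 : 0 < 1 + 4 * al * i by nra.
have h2 : (1 + 4 * al * i) * X <= (1 + 4 * al * i) * (pA * t).
  by apply: ler_wpM2l hX; exact: ltW.
(* Both parameter bounds enter: [tau ^+ 2 <= gamma * tau], [8 * al * tau <= 8 * al * gamma] and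
   [16 * al ^+ 2 <= 8 * al * gamma]. *)
have coef : (tau + 4 * al) ^+ 2 <= gamma * tau + 18 * al * gamma by nra.
(* Young's inequality, weighted so that the term in [pA] is the one built into [rho]. The negative
   coefficient [tau / 2 + 3 * al] of [t ^+ 2] is thereby reduced to [tau / 3]. *)
have h3 : (tau + 4 * al) * (i * pA) * t <=
    3 * gamma / 2 * (i * pA) ^+ 2 + (tau / 6 + 3 * al) * t ^+ 2.
  have g6 : 0 < 6 * gamma by lra.
  rewrite -(ler_pM2l g6).
  have := sqr_ge0 (3 * gamma * (i * pA) - (tau + 4 * al) * t).
  have := ler_wpM2r (sqr_ge0 t) coef; lra.
have m1 : 1 + 4 * al * i = (tau + 4 * al) * i by move: it; lra.
have h4 : al * (1 + 4 * al * i) * (2 * Y) <= al * (1 + 4 * al * i) * (t ^+ 2 + q ^+ 2).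
  by apply: ler_wpM2l hY; apply: mulr_ge0; exact: ltW.
have h5 : 4 * al * i * ((tau + al) * t ^+ 2) <= 4 * al * i * (X + al * Y).
  by apply: ler_wpM2l hmono; apply: mulr_ge0; [lra|exact: ltW].
have h6 : 4 * al * i * ((tau + al) * t ^+ 2) = 4 * al * t ^+ 2 + 4 * al ^+ 2 * i * t ^+ 2.
  by ring: it.
have h7 : (1 + 4 * al * i) * (pA * t) = (tau + 4 * al) * (i * pA) * t.
  by rewrite m1; ring.
rewrite -/i h6 in h5 *; lra.
Qed.

Section Step.
Context {n p s : nat}.
Variables (A : 'M[R]_(s, n)) (K : 'M[R]_(p, n)) (vphi : 'cV[R]_n -> R) (lphi : R).
Variables (al alt gamma mu rho : R).
Hypotheses (al_gt0 : 0 < al) (al_lt : al < alt) (gamma_ge : alt - al <= gamma).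
Hypotheses (gamma_gt : al < gamma / 2) (lphi_ge0 : 0 <= lphi).
Hypotheses (vphi_diff : forall x : 'cV[R]_n, differentiable vphi x).
Hypotheses (vphi_lip : forall x1 x2 : 'cV[R]_n,
  enorm (gradient vphi x1 - gradient vphi x2) <= lphi * enorm (x1 - x2)).
Hypothesis rhoE :
  rho = lphi / 2 + 3 * opnorm A ^+ 2 * gamma / (2 * (alt - al) ^+ 2) + mu.

(** [rho] times the difference between the projected point and its projection [x'], hence normal to
    [S] at [x']. *)
Definition normal_step (x x' : 'cV[R]_n) (y : 'cV[R]_p) (z : 'cV[R]_s) :=
  rho *: (x - x') - gradient vphi x + K^T *m y - A^T *m z.
Definition eta_step (be : R) (x' : 'cV[R]_n) (y y' : 'cV[R]_p) :=
  K *m x' + be *: (y - y').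
Definition xi_step (x' : 'cV[R]_n) (z z' : 'cV[R]_s) :=
  A *m x' + al *: z - alt *: z'.

(** The third inequality, a subgradient at the old [z], bounds the concave part [- G'] and brings in
    [z0] from the step before. Added to the fourth it gives the monotonicity estimate required by
    [descent_scalar]. *)
Lemma merit_descent (be G G' F F' : R) (x x' : 'cV[R]_n) (y y' : 'cV[R]_p)
    (z0 z z' : 'cV[R]_s) :
  dot (normal_step x x' y z) (x - x') <= 0 ->
  F' + dot (eta_step be x' y y') (y - y') <= F ->
  G + dot (xi_step x z0 z) (z' - z) <= G' ->
  G' + dot (xi_step x' z z') (z - z') <= G ->
  merit_real A K vphi al alt x' y' z' z G' F' <=
  merit_real A K vphi al alt x y z z0 G F
  - (mu * enorm (x' - x) ^+ 2 + be * enorm (y' - y) ^+ 2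
     + (alt - al) / 3 * enorm (z' - z) ^+ 2).
Proof.
move=> hx hy hz hz'.
have hphi := lipschitz_gradient_upper vphi_diff vphi_lip x (x' - x).
rewrite (addrCA x) subrr addr0 in hphi.
have tau0 : 0 < alt - al by rewrite subr_gt0.
have hA := enorm_mulmx_le A (x' - x).
have hA2 : enorm (A *m (x' - x)) ^+ 2 <= opnorm A ^+ 2 * enorm (x' - x) ^+ 2.
  rewrite -exprMn ler_pXn2r ?nnegrE ?enorm_ge0//.
  exact: le_trans (enorm_ge0 _) hA.
have hX := CauchySchwarz_dot (A *m (x' - x)) (z' - z).
have hY : 2 * dot (z - z0) (z' - z) <= enorm (z' - z) ^+ 2 + enorm (z - z0) ^+ 2.
  have := dotxx_ge0 ((z - z0) - (z' - z)); rewrite !sqr_enorm.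
  by move: (z - z0) (z' - z) => u v; rewrite !dotE (dotC v u); lra.
have hm : (alt - al + al) * enorm (z' - z) ^+ 2 <=
    dot (A *m (x' - x)) (z' - z) + al * dot (z - z0) (z' - z).
  move: hz hz'; rewrite /xi_step sqr_enorm mulmxBr !dotE.
  by rewrite (dotC z z') ; lra.
have := @descent_scalar _ _ _ _ _ _ _ _ _ _ al_gt0 tau0 gamma_ge gamma_gt hA2 hX hY hm.
have rE : 3 * opnorm A ^+ 2 * gamma / (2 * (alt - al) ^+ 2) = rho - lphi / 2 - mu.
  by rewrite rhoE; ring.
rewrite rE /merit_real.
move: (al / 2 * (1 + 4 * al / (alt - al))) hx hy hz hz' hphi => kap.
rewrite /normal_step /eta_step /xi_step (enormB y' y) -(enormB x x') -(enormB z z').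
rewrite !mulrBr; move: (kap * _) (kap * _) => k1 k2.
have dotT m1 m2 (M : 'M[R]_(m1, m2)) q1 q2 : dot (M^T *m q1) q2 = dot q1 (M *m q2).
  by rewrite dotC -dot_mulmxl dotC.
rewrite !sqr_enorm !(dotE, dotT, mulmxBr, mulmxDr, mulmxN).
rewrite ?(dotC (K *m x) y) ?(dotC (K *m x) y') ?(dotC (K *m x') y) ?(dotC (K *m x') y').
rewrite ?(dotC (A *m x) z) ?(dotC (A *m x) z') ?(dotC (A *m x') z) ?(dotC (A *m x') z').
rewrite ?(dotC x' x) ?(dotC y' y) ?(dotC z' z) ?(dotC z0 z) ?(dotC z0 z').
lra.
Qed.

(** Every block reduces to increments: the [x] block compares new with old gradients and dual
    variables, and in the [z] block [(alt - al) *: z'] cancels all of [xi_step] but an increment.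
    [C] is uniform in [be], which varies along the iteration. *)
Lemma merit_subgrad_step_bound (bup : R) : exists2 C : R, 0 < C &
  forall (be : R) (x x' : 'cV[R]_n) (y y' : 'cV[R]_p) (z z' : 'cV[R]_s),
  0 <= be <= bup ->
  enorm (merit_subgrad A K vphi al alt x' y' z' z (normal_step x x' y z)
    (eta_step be x' y y') (xi_step x' z z'))
  <= C * enorm (merit_point (x' - x) (y' - y) (z' - z) (0 : 'cV[R]_s)).
Proof.
have [CA CA0 hCA] := enorm_mulmx_bounded A^T.
have [CK CK0 hCK] := enorm_mulmx_bounded K^T.
set c := al * (1 + 4 * al / (alt - al)).
have rho0 : 0 <= `|rho| by [].
have c0 : 0 <= `|c| by [].
have l0 := lphi_ge0; have a0 := ltW al_gt0.
exists (1 + CA + CK + lphi + `|rho| + `|bup| + al + `|c| + `|c|) => [|be x x' y y' z z' /andP[be0 be1]].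
  by have := normr_ge0 bup; lra.
have beb : be <= `|bup| by apply: le_trans be1 (ler_norm _).
rewrite /merit_subgrad -/c.
have -> : A^T *m z' + gradient vphi x' - K^T *m y' + normal_step x x' y z =
    A^T *m (z' - z) + (gradient vphi x' - gradient vphi x) - K^T *m (y' - y) - rho *: (x' - x).
  rewrite /normal_step !mulmxBr; move: (A^T *m z) (A^T *m z') (K^T *m y) (K^T *m y').
  by move=> q1 q2 q3 q4; apply/matrixP => i j; rewrite !mxE; ring.
have -> : eta_step be x' y y' - K *m x' = (- be) *: (y' - y).
  by rewrite /eta_step addrAC subrr add0r scaleNr -scalerN opprB.
have -> : A *m x' - xi_step x' z z' + c *: (z' - z) - (alt - al) *: z' = (al + c) *: (z' - z).
  rewrite /xi_step; move: (A *m x') => q.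
  by apply/matrixP => i j; rewrite !mxE; ring.
set N := enorm (merit_point (x' - x) _ _ _).
have N0 : 0 <= N by exact: enorm_ge0.
have N2 := enorm_merit_point (x' - x) (y' - y) (z' - z) 0; rewrite -/N enorm0 in N2.
have [xn0 yn0 zn0] := And3 (enorm_ge0 (x' - x)) (enorm_ge0 (y' - y)) (enorm_ge0 (z' - z)).
have xN : enorm (x' - x) <= N by nra.
have yN : enorm (y' - y) <= N by nra.
have zN : enorm (z' - z) <= N by nra.
apply: le_trans (enorm_merit_point_le _ _ _ _) _.
rewrite [enorm (- (c *: _))]enormN !enormZ normrN (ger0_norm be0).
have h1 : enorm (A^T *m (z' - z) + (gradient vphi x' - gradient vphi x)
    - K^T *m (y' - y) - rho *: (x' - x)) <= CA * N + lphi * N + CK * N + `|rho| * N.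
  apply: le_trans (enormB_le _ _) _; apply: lerD; last first.
    by rewrite enormZ ler_wpM2l.
  apply: le_trans (enormB_le _ _) _; apply: lerD; last first.
    by apply: le_trans (hCK _) _; exact: ler_wpM2l.
  apply: le_trans (enormD_le _ _) _; apply: lerD.
    by apply: le_trans (hCA _) _; exact: ler_wpM2l.
  by apply: le_trans (vphi_lip _ _) _; exact: ler_wpM2l.
have h2 : be * enorm (y' - y) <= `|bup| * N by exact: ler_pM.
have h3 : `|al + c| * enorm (z' - z) <= (al + `|c|) * N.
  by apply: ler_pM => //; apply: le_trans (ler_normD _ _) _; rewrite (ger0_norm a0).
have h4 : `|c| * enorm (z' - z) <= `|c| * N by exact: ler_wpM2l.
lra.
Qed.

End Step.

Lemma cvg_tail_bound d (v : nat -> 'cV[R]_d) (l : 'cV[R]_d) (P : nat -> R) M :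
  v @ \oo --> l ->
  (forall k, (M <= k)%N -> enorm (v k.+1 - v k) <= P k - P k.+1) ->
  (forall k, (M <= k)%N -> 0 <= P k) ->
  forall k, (M <= k)%N -> enorm (v k - l) <= P k.
Proof.
move=> vl vP P0 k Mk; apply/ler_addgt0Pr => e e0.
have tele j : enorm (v (k + j)%N - v k) <= P k - P (k + j)%N.
  elim: j => [|j IH]; first by rewrite addn0 !subrr enorm0.
  rewrite addnS; have := vP _ (leq_trans Mk (leq_addr j k)).
  have := enorm_dist_triangle (v (k + j).+1) (v (k + j)%N) (v k); lra.
have : \forall m \near \oo, enorm (v m - l) < e.
  apply: (vl [set y | enorm (y - l) < e]).
  by apply/nbhs_enormP; exists e.
move=> [m _ hm]; have ml := hm (k + m)%N (leq_addl _ _).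
have := enorm_dist_triangle (v k) (v (k + m)%N) l; rewrite (enormB (v k) (v _)).
have := tele m; have := P0 _ (leq_trans Mk (leq_addr m k)); move: ml => /=; lra.
Qed.

(** Convergence of [w] and [H] brings the points into the KL neighbourhood and the values below its
    upper level. There the derivative of the desingularization is [sigma] times the power [- theta],
    and [enorm (v k)] bounds the distance to the subdifferential. *)
Lemma KL_property_power d (Dreg : set 'cV[R]_d) (h : 'cV[R]_d -> \bar R)
    (sigma theta Hb : R) (wb : 'cV[R]_d) (w v : nat -> 'cV[R]_d) (H : nat -> R) N :
  0 < sigma -> theta < 1 ->
  KL_property Dreg h (fun t => sigma / (1 - theta) * t `^ (1 - theta)) wb ->
  h wb = Hb%:E -> (forall k, (N <= k)%N -> h (w k) = (H k)%:E) ->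
  (forall k, (N <= k)%N -> lim_subdiff h (w k) (v k)) ->
  w @ \oo --> wb -> H @ \oo --> Hb ->
  exists2 M, (N <= M)%N & forall k, (M <= k)%N -> 0 < H k - Hb ->
    (H k - Hb) `^ theta <= sigma * enorm (v k).
Proof.
move=> s0 th1 [_ [eta [U [eta0 [Uo Uwb] _ _ hKL]]]] hwb hw hv wwb HHb.
have Unear : \forall k \near \oo, U (w k) by apply: wwb; exact: open_nbhs_nbhs.
have Hnear : \forall k \near \oo, ((H k)%:E < Hb%:E + eta)%E.
  case: eta eta0 {hKL} => [e| |]//; rewrite ?lte_fin => e0; last first.
    by near=> k; rewrite ltry.
  have : \forall k \near \oo, H k < Hb + e by apply: (cvgr_lt _ HHb); lra.
  by apply: filterS => k; rewrite -EFinD lte_fin.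
have [M1 _ hM1] := Unear; have [M2 _ hM2] := Hnear.
exists (maxn N (maxn M1 M2)) => [|k]; first exact: leq_maxl.
rewrite !geq_max => /and3P[Nk M1k M2k] HkHb.
have := hKL _ (hM1 k M1k); rewrite hwb (hw k Nk) lte_fin -subr_gt0 => /(_ HkHb (hM2 k M2k)).
rewrite -EFinB /=.
have -> : derive1 (fun t => sigma / (1 - theta) * t `^ (1 - theta)) (H k - Hb) =
    sigma * (H k - Hb) `^ (- theta).
  rewrite derive1E.
  have ? := @is_derive1_powR R (1 - theta) _ HkHb.
  have -> : (fun t => sigma / (1 - theta) * t `^ (1 - theta)) =
      (sigma / (1 - theta)) \*: (@powR R ^~ (1 - theta)) by [].
  rewrite derive_val /GRing.scale /= (_ : 1 - theta - 1 = - theta); last by ring.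
  by rewrite mulrA divfK// gt_eqF// subr_gt0.
have dv : (dist 0 (lim_subdiff h (w k)) <= (enorm (v k))%:E)%E.
  apply: ereal_inf_lbound; exists (v k); first exact: hv.
  by rewrite sub0r enormN.
have X0 := powR_gt0 theta HkHb.
rewrite powRN; move: ((H k - Hb) `^ theta) X0 => X X0.
have sX0 : (0 <= (sigma * X^-1)%:E)%E by rewrite lee_fin; apply/ltW/divr_gt0.
move=> h1; have := le_trans h1 (lee_wpmul2l sX0 dv).
rewrite -EFinM lee_fin => h2.
by rewrite -[leLHS]mul1r -ler_pdivlMr// mulrAC.
Unshelve. all: end_near. Qed.

End Iteration.

(** * Convergence of conjugate values and other limits along the iterates *)

Section Limits.
Context {R : realType}.

Lemma cvg_enorm0P d (v : nat -> 'cV[R]_d) :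
  v @ \oo --> (0 : 'cV[R]_d) <-> (fun k => enorm (v k)) @ \oo --> (0 : R).
Proof. by rewrite cvg_enormP; under [fun k => _]eq_fun do rewrite subr0. Qed.

(** The subgradient inequality at [z] bounds [G_ k] from below, the one at [z_ k] bounds it from
    above, and both bounds tend to [G]. *)
Lemma cvg_conjugate d (h : 'cV[R]_d -> \bar R) (z_ xi_ : nat -> 'cV[R]_d) z xi
    (G_ : nat -> R) (G : R) N :
  (forall k, (N <= k)%N -> conjugate h (z_ k) = (G_ k)%:E) ->
  (forall k, (N <= k)%N -> subgradient h (xi_ k) (z_ k)) ->
  conjugate h z = G%:E -> subgradient h xi z ->
  z_ @ \oo --> z -> xi_ @ \oo --> xi -> G_ @ \oo --> G.
Proof.
move=> hG_ s_ hG s zz xixi; have zz' : (fun k => z - z_ k) @ \oo --> (0 : 'cV[R]_d).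
  by rewrite -(subrr z); apply: cvgB => //; exact: cvg_cst.
have zz'' : (fun k => z_ k - z) @ \oo --> (0 : 'cV[R]_d).
  by rewrite -(subrr z); apply: cvgB => //; exact: cvg_cst.
apply: (@squeeze_cvgr _ _ _ _ (fun k => G + dot xi (z_ k - z))
  (fun k => G - dot (xi_ k) (z - z_ k))).
- near=> k; have Nk : (N <= k)%N by near: k; exact: nbhs_infty_ge.
  have [r hr Hr] := subgradient_conjugate s; have := Hr (z_ k).
  have [r' hr' Hr'] := subgradient_conjugate (s_ k Nk); have := Hr' z.
  move: hr hr'; rewrite hG hG_// => -[<-] [<-]; rewrite !lee_fin; lra.
- rewrite -[X in _ --> X]addr0 -(dot0r xi); apply: cvgD; first exact: cvg_cst.
  by apply: cvg_dot => //; exact: cvg_cst.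
- rewrite -[X in _ --> X]subr0 -(dot0r xi); apply: cvgB; first exact: cvg_cst.
  exact: cvg_dot.
Unshelve. all: end_near. Qed.

(** Serves for [beta k *: (y k - y k.+1)], where the weights are bounded but may have no limit. *)
Lemma cvg_bounded_scale d (b : nat -> R) (v : nat -> 'cV[R]_d) (M : R) :
  (forall k, `|b k| <= M) -> v @ \oo --> (0 : 'cV[R]_d) ->
  (fun k => b k *: v k) @ \oo --> (0 : 'cV[R]_d).
Proof.
move=> bM /cvg_enorm0P v0; apply/cvg_enorm0P.
apply: (@squeeze_cvgr _ _ _ _ (fun=> 0) (fun k => M * enorm (v k))).
- near=> k; rewrite enorm_ge0 enormZ/=.
  by apply: ler_wpM2r; [exact: enorm_ge0|exact: bM].
- exact: cvg_cst.
- by rewrite -[X in _ --> X](mulr0 M); apply: cvgM => //; exact: cvg_cst.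
Unshelve. all: end_near. Qed.

Lemma natr_powRN_shift (e : R) (k : nat) : 0 <= e -> (0 < k)%N ->
  k%:R `^ (- e) <= 2 `^ e * k.+1%:R `^ (- e).
Proof.
move=> e0 k0; have kR : 0 < k%:R :> R by rewrite ltr0n.
have h : k.+1%:R `^ e <= (2 * k%:R) `^ e.
  by apply: powR_le2r => //; rewrite -natrM ler_nat mul2n -addnn -add1n leq_add2r.
rewrite powRM// in h; rewrite !powRN ler_pdivlMr ?powR_gt0// mulrC.
by rewrite ler_pdivrMr ?powR_gt0.
Qed.

End Limits.

Theorem theorem6p4 (R : realType) (n p s : nat)
  (S : set 'cV[R]_n) (f : 'cV[R]_p -> \bar R) (g : 'cV[R]_s -> \bar R)
  (A : 'M[R]_(s, n)) (K : 'M[R]_(p, n)) (vphi : 'cV[R]_n -> R) (lphi : R)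
  (S_neq0 : S !=set0) (S_convex : convex_set S) (S_compact : compact S)
  (f_proper : eproper f) (f_convex : econvex f) (f_lsc : lower_semicontinuous f)
  (g_proper : eproper g) (g_convex : econvex g) (g_lsc : lower_semicontinuous g)
  (vphi_diff : forall x : 'cV[R]_n, differentiable vphi x)
  (lphi_gt0 : 0 < lphi)
  (vphi_lip : forall x1 x2 : 'cV[R]_n,
     enorm (gradient vphi x1 - gradient vphi x2) <= lphi * enorm (x1 - x2))
  (sigmaA : R) (sigmaAE : sigmaA = opnorm A ^+ 2) (sigmaA_gt0 : 0 < sigmaA)
  (AS_ri : [set A *m x | x in S] `<=` rel_interior (edom g))
  (F_bounded : (-oo < ereal_inf [set objective f g A K vphi x | x in S])%E)
  (KS_ri : [set K *m x | x in S] `<=` rel_interior (edom f))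
  (r : R) (r_gt0 : 0 < r)
  (Kr : set 'cV[R]_s)
  (KrE : Kr = [set z | (dist z [set A *m x | x in S] <= r%:E)%E])
  (Kr_int : Kr `<=` (edom g)°)
  (lg : R) (lg_gt0 : 0 < lg)
  (g_lip : forall z1 z2 : 'cV[R]_s, Kr z1 -> Kr z2 ->
     (`|g z1 - g z2| <= (lg * enorm (z1 - z2))%:E)%E)
  (gamma al mu eps : R)
  (gamma_gt0 : 0 < gamma) (gamma_le : gamma <= 2 * r / lg)
  (al_gt0 : 0 < al) (al_lt : al < gamma / 2) (mu_gt0 : 0 < mu)
  (eps_gt0 : 0 < eps) (eps_le : eps <= r)
  (a alpha beta delta rho : nat -> R)
  (x : nat -> 'cV[R]_n) (y : nat -> 'cV[R]_p) (z : nat -> 'cV[R]_s)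
  (z0_le : enorm (z 0%N) <= lg)
  (hP1 : P1 gamma al a) (hP2 : P2 gamma al a) (hP3 : P3 beta)
  (hP4 : P4 al alpha delta) (hP5 : P5 lphi sigmaA gamma al mu alpha rho)
  (algorithm : adaptive_DPFS S f g A K vphi gamma al eps a
                 alpha beta delta rho x y z)
  (g_esc : essentially_strictly_convex g)
  (f_int : (edom f)° !=set0)
  (K0 : nat) (alt : R) (alt_gt : al < alt)
  (K0P : forall k, (K0 <= k)%N ->
     [/\ alpha k = alt,
         rho k = lphi / 2 + 3 * sigmaA * gamma / (2 * (alt - al) ^+ 2) + mu,
         delta k = al / alt &
         (alpha k - al) * enorm (z k.+1) <= eps])
  (theta : R) (theta_ge0 : 0 <= theta) (theta_lt1 : theta < 1)
  (KL : forall w, dom_subdiff (merit_vec S f g A K vphi al alt) w ->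
     exists2 sigma : R, 0 < sigma &
       KL_property (@merit_region R n p s g)
         (merit_vec S f g A K vphi al alt)
         (fun t : R => sigma / (1 - theta) * t `^ (1 - theta)) w)
  (xbar : 'cV[R]_n) (ybar : 'cV[R]_p) (zbar : 'cV[R]_s)
  (x_cvg : x @ \oo --> xbar) (y_cvg : y @ \oo --> ybar)
  (z_cvg : z @ \oo --> zbar) :
  [/\ theta = 0 ->
        exists N : nat, forall k, (N <= k)%N ->
          [/\ x k = xbar, y k = ybar & z k = zbar],
      0 < theta <= 2^-1 ->
        exists (K1 : nat) (q kappa : R),
          [/\ (K0 + 2 <= K1)%N, 0 < q < 1, 0 < kappa &
              forall k, (K1 <= k)%N ->
                [/\ enorm (x k - xbar) <= kappa * q ^+ k,
                    enorm (y k - ybar) <= kappa * q ^+ k &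
                    enorm (z k - zbar) <= kappa * q ^+ k]] &
      2^-1 < theta < 1 ->
        exists (K1 : nat) (kappa : R),
          [/\ (K0 + 2 <= K1)%N, 0 < kappa &
              forall k, (K1 <= k)%N ->
                [/\ enorm (x k - xbar) <=
                      kappa * k%:R `^ (- ((1 - theta) / (2 * theta - 1))),
                    enorm (y k - ybar) <=
                      kappa * k%:R `^ (- ((1 - theta) / (2 * theta - 1))) &
                    enorm (z k - zbar) <=
                      kappa * k%:R `^ (- ((1 - theta) / (2 * theta - 1)))]]].
Proof.
have [blo [bup [blo0 hbeta]]] := hP3.
have beta0 k : 0 < beta k by have /andP[] := hbeta k; lra.
have [hx hy hz _ halpha] := algorithm.
have tau0 : 0 < alt - al by rewrite subr_gt0.
have alt0 : 0 < alt by lra.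
(* [alt] is a term of the sequence [a], whose terms are at most [a 0]. *)
have gamma_ge : alt - al <= gamma.
  have [altE _ _ _] := K0P _ (leqnn K0); have := halpha K0.
  rewrite altE; case: hP1 => _ /(_ (nb_updates al eps alpha z K0))[+ + _ _].
  by move=> h1 h2 h3; lra.
pose rho0 := lphi / 2 + 3 * opnorm A ^+ 2 * gamma / (2 * (alt - al) ^+ 2) + mu.
have rhoK k : (K0 <= k)%N -> rho k = rho0.
  by move=> Kk; have [_ -> _ _] := K0P _ Kk; rewrite sigmaAE.
have rho0_gt0 : 0 < rho0.
  rewrite /rho0 ltr_wpDl// addr_ge0//; first by lra.
  by apply: divr_ge0; apply: mulr_ge0; rewrite ?sqr_ge0//; [apply: mulr_ge0; rewrite ?sqr_ge0|lra].
have Sx k : S (x k.+1) by have [] := hx k.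
have hN k : (K0 <= k)%N -> forall c, S c ->
    dot (normal_step A K vphi rho0 (x k) (x k.+1) (y k) (z k)) (c - x k.+1) <= 0.
  move=> Kk c Sc; have := proj_normal S_convex (hx k) Sc; rewrite rhoK//.
  set q := _ - x k.+1 => hq.
  have -> : normal_step A K vphi rho0 (x k) (x k.+1) (y k) (z k) = rho0 *: q.
    rewrite /normal_step /q; move: (K^T *m y k) (A^T *m z k) (gradient vphi (x k)) => q1 q2 q3.
    by apply/matrixP => i j; rewrite !mxE; field; rewrite gt_eqF.
  by rewrite dotZl mulr_ge0_le0// ltW.
have sf k : subgradient f (eta_step K (beta k) (x k.+1) (y k) (y k.+1)) (y k.+1).
  have := prox_conjugate_subgradient (beta0 k) f_proper f_convex f_lsc (hy k).
  congr (subgradient f _ _); rewrite /eta_step; move: (K *m x k.+1) => q.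
  by apply/matrixP => i j; rewrite !mxE; field; rewrite gt_eqF.
have sg k : (K0 <= k)%N ->
    subgradient g (xi_step A al alt (x k.+1) (z k) (z k.+1)) (z k.+1).
  move=> Kk; have := hz k; have [-> _ -> _] := K0P _ Kk.
  move=> /(prox_conjugate_subgradient alt0 g_proper g_convex g_lsc).
  congr (subgradient g _ _); rewrite /xi_step; move: (A *m x k.+1) => q.
  by apply/matrixP => i j; rewrite !mxE; field; rewrite gt_eqF.
pose G k := fine (conjugate g (z k.+1)); pose F k := fine (conjugate f (y k.+1)).
have hG k : (K0 <= k)%N -> conjugate g (z k.+1) = (G k)%:E.
  by move=> /sg/subgradient_conjugate/subgradient_finite/fineK.
have hF k : conjugate f (y k.+1) = (F k)%:E.
  by have /subgradient_conjugate/subgradient_finite/fineK := sf k.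
pose h := merit_vec S f g A K vphi al alt.
pose w k := merit_point (x k.+1) (y k.+1) (z k.+1) (z k).
pose H k := merit_real A K vphi al alt (x k.+1) (y k.+1) (z k.+1) (z k) (G k) (F k).
pose v k := merit_subgrad A K vphi al alt (x k.+1) (y k.+1) (z k.+1) (z k)
  (normal_step A K vphi rho0 (x k) (x k.+1) (y k) (z k))
  (eta_step K (beta k) (x k.+1) (y k) (y k.+1))
  (xi_step A al alt (x k.+1) (z k) (z k.+1)).
(* The last block is 0: the descent and the subgradient bound involve the increments of [x], [y] and
   [z] alone. *)
pose D k := enorm (merit_point (x k.+1 - x k) (y k.+1 - y k) (z k.+1 - z k) (0 : 'cV[R]_s)).
have hw k : (K0 <= k)%N -> h (w k) = (H k)%:E.
  move=> Kk; rewrite /h /merit_vec /w !merit_pointE.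
  by apply: meritE; [exact: Sx|exact: hG|exact: hF].
have hfv k : (K0 <= k)%N -> frechet_subdiff h (w k) (v k).
  move=> Kk; rewrite /h /w /v; apply: (@merit_frechet _ _ _ _ _ _ _ _ _ _ _ _ lphi) => //.
  - exact: ltW.
  - exact: hN.
  - exact: sg.
have [C C0 vD] := merit_subgrad_step_bound A K alt rho0 al_gt0 (ltW lphi_gt0) vphi_lip bup.
have hvD k : enorm (v k) <= C * D k.
  by apply: vD; have /andP[_ ->] := hbeta k; rewrite ltW.
have xS : (fun k => x k.+1) @ \oo --> xbar by rewrite cvg_shiftS.
have yS : (fun k => y k.+1) @ \oo --> ybar by rewrite cvg_shiftS.
have zS : (fun k => z k.+1) @ \oo --> zbar by rewrite cvg_shiftS.
have dx : (fun k => x k.+1 - x k) @ \oo --> (0 : 'cV[R]_n).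
  by rewrite -(subrr xbar); exact: cvgB.
have dy : (fun k => y k.+1 - y k) @ \oo --> (0 : 'cV[R]_p).
  by rewrite -(subrr ybar); exact: cvgB.
have dz : (fun k => z k.+1 - z k) @ \oo --> (0 : 'cV[R]_s).
  by rewrite -(subrr zbar); exact: cvgB.
have merit0 : merit_point (0 : 'cV[R]_n) (0 : 'cV[R]_p) (0 : 'cV[R]_s) (0 : 'cV[R]_s) = 0.
  by rewrite /merit_point !col_mx0.
have D0 : D @ \oo --> (0 : R).
  by apply/cvg_enorm0P; rewrite -merit0; exact: cvg_merit_point (cvg_cst _).
have v0 : v @ \oo --> (0 : 'cV[R]_(n + (p + (s + s)))).
  apply/cvg_enorm0P.
  apply: (@squeeze_cvgr _ _ _ _ (fun=> 0) (fun k => C * D k)).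
  - by near=> k; rewrite enorm_ge0 hvD.
  - exact: cvg_cst.
  - by rewrite -[X in _ --> X](mulr0 C); apply: cvgM => //; exact: cvg_cst.
have Sxbar : S xbar.
  have Scl : closed S := compact_closed (@norm_hausdorff _ _) S_compact.
  apply: (closed_cvg _ Scl _ _ xS).
  by near=> k; exact: Sx.
have etaS : (fun k => eta_step K (beta k) (x k.+1) (y k) (y k.+1)) @ \oo --> K *m xbar.
  rewrite -[X in _ --> X]addr0; apply: cvgD; first exact: cvg_mulmx.
  apply: (@cvg_bounded_scale _ _ _ _ bup).
    by move=> k; have /andP[_] := hbeta k; rewrite ger0_norm// ltW.
  by rewrite -(subrr ybar); exact: cvgB.
have xiS : (fun k => xi_step A al alt (x k.+1) (z k) (z k.+1)) @ \oo -->
    A *m xbar + al *: zbar - alt *: zbar.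
  apply: cvgB; first apply: cvgD; first exact: cvg_mulmx.
    by apply: cvgZ => //; exact: cvg_cst.
  by apply: cvgZ => //; exact: cvg_cst.
have sfbar := subgradient_closed f_proper f_lsc etaS yS (fun k (_ : (0 <= k)%N) => sf k).
have sgbar := subgradient_closed g_proper g_lsc xiS zS sg.
have [Fb hFb _] := subgradient_conjugate sfbar.
have [Gb hGb _] := subgradient_conjugate sgbar.
have FFb : F @ \oo --> Fb.
  exact: (cvg_conjugate (fun k (_ : (0 <= k)%N) => hF k) (fun k _ => sf k) hFb sfbar yS etaS).
have GGb : G @ \oo --> Gb by exact: (cvg_conjugate hG sg hGb sgbar zS xiS).
pose wb := merit_point xbar ybar zbar zbar.
pose Hb := merit_real A K vphi al alt xbar ybar zbar zbar Gb Fb.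
have hwb : h wb = Hb%:E.
  by rewrite /h /merit_vec /wb !merit_pointE; exact: meritE.
have wwb : w @ \oo --> wb by exact: cvg_merit_point.
have cvg_sqr_enorm d (u_ : nat -> 'cV[R]_d) u : u_ @ \oo --> u ->
    (fun k => enorm (u_ k) ^+ 2) @ \oo --> enorm u ^+ 2.
  by move=> uu; under eq_fun do rewrite sqr_enorm; rewrite sqr_enorm; exact: cvg_dot.
have HHb : H @ \oo --> Hb.
  apply: cvgB; last by apply: cvgM; [exact: cvg_cst|exact: cvg_sqr_enorm].
  apply: cvgD; last first.
    apply: cvgM; first exact: cvg_cst.
    by apply: cvg_sqr_enorm; exact: cvgB.
  apply: cvgD => //; apply: cvgB; last by apply: cvg_dot => //; exact: cvg_mulmx.
  apply: cvgD; first by apply: cvgB => //; apply: cvg_dot => //; exact: cvg_mulmx.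
  exact: (cvg_comp _ _ xS (differentiable_continuous (vphi_diff xbar))).
(* The KL hypothesis applies at the limit because 0, the limit of [v], is a limiting subgradient
   there. The shift by [K0] is due to the relation for [z], which holds from [K0] on. *)
have wbdom : dom_subdiff h wb.
  exists 0; split; first by rewrite hwb.
  exists (fun k => w (k + K0)%N), (fun k => v (k + K0)%N); split.
  - by move=> k; apply: hfv; exact: leq_addl.
  - by rewrite cvg_shiftn.
  - rewrite hwb (_ : _ \o _ = fun k => (H (k + K0)%N)%:E); last first.
      by apply/funext => k /=; rewrite hw// leq_addl.
    by apply: cvg_EFin; [near=> k|rewrite cvg_shiftn].
  - by rewrite cvg_shiftn.
have [sigma sigma0 hKL] := KL wb wbdom.
have hlv k : (K0 <= k)%N -> lim_subdiff h (w k) (v k).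
  by move=> /hfv/frechet_lim_subdiff.
have [N K0N hKLN] := KL_property_power sigma0 theta_lt1 hKL hwb hw hlv wwb HHb.
pose E k := H k - Hb.
have E_cvg0 : E @ \oo --> (0 : R).
  by rewrite -(subrr Hb); apply: cvgB => //; exact: cvg_cst.
(* The least of the three descent coefficients, [beta] being replaced by its lower bound. *)
pose c1 := Num.min mu (Num.min blo ((alt - al) / 3)).
have c1_gt0 : 0 < c1 by rewrite !lt_min mu_gt0 blo0/= divr_gt0.
have E_decr k : (N <= k)%N -> E k.+1 + c1 * D k.+1 ^+ 2 <= E k.
  move=> Nk; have Kk := leq_trans K0N Nk; have Kk1 := leqW Kk.
  have mono (d : nat) (hh : 'cV[R]_d -> \bar R) xi z1 z2 (g1 g2 : R) : subgradient hh xi z1 ->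
      conjugate hh z1 = g1%:E -> conjugate hh z2 = g2%:E -> g1 + dot xi (z2 - z1) <= g2.
    by move=> /subgradient_conjugate[r1 -> hr] [<-] h2; have := hr z2; rewrite h2 lee_fin.
  (* From [H k] to [H k.+1] the algorithm moves from [k.+1] to [k.+2]; the subgradient of
     [conjugate g] at the old point comes from the step before, hence both [sg k] and [sg k.+1]. *)
  have := merit_descent al_gt0 alt_gt gamma_ge al_lt vphi_diff vphi_lip (erefl rho0)
    (hN _ Kk1 _ (Sx k)) (mono _ _ _ _ _ _ _ (sf k.+1) (hF k.+1) (hF k))
    (mono _ _ _ _ _ _ _ (sg k Kk) (hG k Kk) (hG _ Kk1))
    (mono _ _ _ _ _ _ _ (sg _ Kk1) (hG _ Kk1) (hG k Kk)).
  rewrite -/(H k) -/(H k.+1) /E /D enorm_merit_point enorm0.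
  have m1 : c1 <= mu by rewrite /c1 ge_min lexx.
  have m2 : c1 <= beta k.+1.
    by have /andP[+ _] := hbeta k.+1; apply: le_trans; rewrite /c1 !ge_min lexx orbT.
  have m3 : c1 <= (alt - al) / 3 by rewrite /c1 !ge_min lexx !orbT.
  have := ler_wpM2r (sqr_ge0 (enorm (x k.+2 - x k.+1))) m1.
  have := ler_wpM2r (sqr_ge0 (enorm (y k.+2 - y k.+1))) m2.
  have := ler_wpM2r (sqr_ge0 (enorm (z k.+2 - z k.+1))) m3.
  by rewrite expr0n /=; lra.
have D_ge0 k : 0 <= D k by exact: enorm_ge0.
(* A nonincreasing sequence with limit 0 has no negative term. *)
have E_ge0 k : (N <= k)%N -> 0 <= E k.
  move=> Nk; rewrite leNgt; apply/negP => Ek.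
  have Edec j : E (k + j)%N <= E k.
    elim: j => [|j IH]; first by rewrite addn0.
    rewrite addnS; apply: le_trans IH.
    apply: le_trans (E_decr _ (leq_trans Nk (leq_addr j k))).
    by rewrite lerDl mulr_ge0 ?sqr_ge0// ltW.
  have [M _ hM] : \forall m \near \oo, E k < E m by apply: (cvgr_gt _ E_cvg0).
  by have := hM (k + M)%N (leq_addl _ _); rewrite /= ltNge Edec.
have sC0 : 0 < sigma * C by exact: mulr_gt0.
have E_KL k : (N <= k)%N -> 0 < E k -> E k `^ theta <= sigma * C * D k.
  move=> Nk Ek; apply: le_trans (hKLN k Nk Ek) _.
  by rewrite -mulrA; apply: ler_wpM2l; [exact: ltW|exact: hvD].
have coordD k : [/\ enorm (x k.+2 - x k.+1) <= D k.+1,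
    enorm (y k.+2 - y k.+1) <= D k.+1 & enorm (z k.+2 - z k.+1) <= D k.+1].
  have := enorm_merit_point (x k.+2 - x k.+1) (y k.+2 - y k.+1) (z k.+2 - z k.+1)
    (0 : 'cV[R]_s); rewrite -/(D k.+1) enorm0 => D2.
  have [d0 x0 y0 z0] := And4 (D_ge0 k.+1) (enorm_ge0 (x k.+2 - x k.+1))
    (enorm_ge0 (y k.+2 - y k.+1)) (enorm_ge0 (z k.+2 - z k.+1)).
  by split; nra.
have tail M (P : nat -> R) : (forall k, (M <= k)%N -> D k.+1 <= P k - P k.+1) ->
    (forall k, (M <= k)%N -> 0 <= P k) -> forall k, (M <= k)%N ->
    [/\ enorm (x k.+1 - xbar) <= P k, enorm (y k.+1 - ybar) <= P k &
        enorm (z k.+1 - zbar) <= P k].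
  move=> DP P0 k Mk; split.
  - apply: (cvg_tail_bound xS _ P0 Mk) => j Mj.
    by apply: le_trans (DP j Mj); have [] := coordD j.
  - apply: (cvg_tail_bound yS _ P0 Mk) => j Mj.
    by apply: le_trans (DP j Mj); have [] := coordD j.
  - apply: (cvg_tail_bound zS _ P0 Mk) => j Mj.
    by apply: le_trans (DP j Mj); have [] := coordD j.
split.
- move=> th0.
  have [M NM hM] := KL_finite sC0 c1_gt0 E_ge0 D_ge0 E_decr E_KL E_cvg0 th0.
  exists M.+1; case=> // k; rewrite ltnS => Mk.
  have [||hx0 hy0 hz0] := tail M (fun=> 0) _ _ k Mk; first by move=> j /hM ->; rewrite subrr.
    by [].
  by split; apply/subr0_eq/enorm_eq0/eqP; rewrite eq_le enorm_ge0 andbT.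
- move=> th; have [M [q [kappa [NM /andP[q0 q1] kappa0 hM]]]] :=
    KL_linear sC0 c1_gt0 E_ge0 D_ge0 E_decr E_KL E_cvg0 th.
  (* [tail] bounds the iterate [k.+1] by [P k]; dividing [kappa] by [q] makes up for this shift. *)
  exists (maxn (K0 + 2) M.+1), q, (kappa / q); split.
  + exact: leq_maxl.
  + by rewrite q0.
  + exact: divr_gt0.
  case=> [|k]; rewrite geq_max => /andP[] // _; rewrite ltnS => Mk.
  rewrite exprS mulrA divfK ?gt_eqF//.
  by apply: tail hM _ _ Mk => j _; rewrite mulr_ge0 ?exprn_ge0// ltW.
- move=> th; have [M [P [kappa [NM kappa0 hM]]]] :=
    KL_sublinear sC0 c1_gt0 E_ge0 D_ge0 E_decr E_KL E_cvg0 th.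
  set e := (1 - theta) / (2 * theta - 1) in hM *.
  have e0 : 0 <= e by have /andP[? ?] := th; apply: divr_ge0; lra.
  (* The power of 2 converts the rate at [k] into the rate at [k.+1], using [k.+1 <= 2 * k];
     starting at [M.+2] ensures [0 < k]. *)
  exists (maxn (K0 + 2) M.+2), (kappa * 2 `^ e); split.
  + exact: leq_maxl.
  + by rewrite mulr_gt0// powR_gt0.
  case=> [|k]; rewrite geq_max => /andP[] // _; rewrite ltnS => Mk.
  have Mk' := ltnW Mk.
  have Pk : P k <= kappa * 2 `^ e * k.+1%:R `^ (- e).
    have [_ _ h1] := hM k Mk'; apply: le_trans h1 _; rewrite -mulrA.
    apply: ler_wpM2l; first exact: ltW.
    by apply: natr_powRN_shift => //; exact: leq_ltn_trans Mk.
  have [h1 h2 h3] := tail M P (fun j Mj => let: And3 a _ _ := hM j Mj in a)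
    (fun j Mj => let: And3 _ b _ := hM j Mj in b) k Mk'.
  by split; apply: le_trans Pk.
Unshelve. all: end_near. Qed.
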